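(* Let $\Gamma$ be a tropical curve of genus $g\ge2$ and let $D$ be a divisor on $\Gamma$ of degree $d$ and nonnegative rank $r$. For each $\underline n\in\mathcal S(r,d)$, the set \[ \operatorname{WL}_{\ge\underline n}(D)=\{p\in\Gamma \mid \underline n_D(p)\ge\underline n\} \] is closed in $\Gamma$ and has finitely many connected components.
   Context: A tropical curve (metric graph) $\Gamma$ is a compact connected metric space with the path metric in which every point $p$ has an open neighborhood isometric to a star with $m=\operatorname{val}(p)\ge 1$ branches of some radius $\varepsilon>0$ centered at $p$ (equivalently, it is obtained from a finite connected graph with positive edge lengths). Its genus is $\dim_{\mathbb R}H_1(\Gamma,\mathbb R)$. $T_p\Gamma$ is the set of outgoing tangent directions at $p$. $\operatorname{Div}(\Gamma)$ is the free abelian group on the points of $\Gamma$; $D=\sum_p D(p)(p)$, $\deg D=\sum_p D(p)$, and $D$ is effective if all $D(p)\ge 0$. A rational function is a continuous piecewise affine function $f:\Gamma\to\mathbb R$ with integer slopes; $\operatorname{sl}_{p,\nu}(f)$ is its outgoing slope at $p$ along $\nu\in T_p\Gamma$, and $\operatorname{div}(f)=\sum_p\bigl(-\sum_{\nu\in T_p\Gamma}\operatorname{sl}_{p,\nu}(f)\bigr)(p)$. $D\sim E$ means $D-E=\operatorname{div}(f)$ for some rational function $f$. The (Baker–Norine) rank $\mathbf r(D)$ is the maximum among $-1$ and the integers $k\ge0$ such that for all $p_1,\dots,p_k\in\Gamma$ the divisor $D-(p_1)-\cdots-(p_k)$ is linearly equivalent to an effective divisor. Gap sequences: for $D$ of degree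 $d$ and rank $r\ge 0$ and $p\in\Gamma$, $\underline n_D(p)=(n_1<\cdots<n_{r+1})$ lists the positive integers $m$ with $\mathbf r(D-m(p))<\mathbf r(D-(m-1)(p))$; there are exactly $r+1$ of them, all $\le d+1$. $\mathcal S(r,d)=\{\underline n=(n_1,\dots,n_{r+1})\in\mathbb Z^{r+1}\mid 1\le n_1<\cdots<n_{r+1}\le d+1\}$, with the coordinatewise partial order: $\underline n\le\underline n'$ iff $n_i\le n_i'$ for all $i$. *)

(* Defs.v *)
From HB Require Import structures.
From mathcomp Require Import all_boot all_order all_algebra.
From mathcomp Require Import all_classical all_reals all_analysis.
From mathcomp Require Import finmap freeg.

Set Implicit Arguments.
Unset Strict Implicit.
Unset Printing Implicit Defensive.

Import Order.TTheory GRing.Theory Num.Theory.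
Import numFieldNormedType.Exports.

Local Open Scope classical_set_scope.
Local Open Scope ring_scope.

(** * Path metrics *)

Section PathMetric.
Context {R : realType} {T : metricType R}.

Definition is_path (x y : T) (c : R -> T) : Prop :=
  [/\ {within `[0, 1], continuous c}, c 0 = x & c 1 = y].

Definition path_length (c : R -> T) : \bar R :=
  ereal_sup [set (\sum_(0 <= k < size s)
                    mdist (c (nth 1 (0 :: s) k)) (c (nth 1 s k)))%:E
            | s in itv_partition 0 1].

Definition is_path_metric : Prop :=
  forall x y : T,
    (mdist x y)%:E = ereal_inf [set path_length c | c in is_path x y].

End PathMetric.

Arguments is_path_metric {R} T.

(** * Tropical curves *)

(* For every point [p] the record carries a star chart: the [valence p]
   branches of the star of radius [star_radius p] are parametrised by arc
   length, so that [branch i t] is the point at distance [t] from [p] on the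
   [i]-th branch; only the values for [0 <= t < star_radius p] matter.  The
   outgoing tangent directions at [p] are the elements of ['I_(valence p)]. *)
Record tropical_curve (R : realType) := TropicalCurve {
  point_of :> metricType R;
  curve_nonempty : [set: point_of] !=set0;
  curve_compact : compact [set: point_of];
  curve_connected : connected [set: point_of];
  curve_path_metric : is_path_metric point_of;
  valence : point_of -> nat;
  star_radius : point_of -> R;
  branch : forall p : point_of, 'I_(valence p) -> R -> point_of;
  valence_ge1 : forall p, (1 <= valence p)%N;
  star_radius_gt0 : forall p, 0 < star_radius p;
  branch0 : forall p (i : 'I_(valence p)), branch i 0 = p;
  star_open : forall p,
    open [set x | exists (i : 'I_(valence p)) t,
            0 <= t < star_radius p /\ x = branch i t];
  star_isometry : forall p (i j : 'I_(valence p)) s t,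
    0 <= s < star_radius p -> 0 <= t < star_radius p ->
    mdist (branch i s) (branch j t) = if i == j then `|s - t| else s + t
}.

(** * Genus: dimension of singular [H_1] with real coefficients *)

Section SingularHomology.
Context {R : realType}.

Definition std_simplex (n : nat) : set 'rV[R]_n.+1 :=
  [set x | (forall i, 0 <= x 0 i) /\ \sum_i x 0 i = 1].

Arguments std_simplex : clear implicits.

Definition face_row (n : nat) (i : 'I_n.+2) (x : 'rV[R]_n.+1) : 'rV[R]_n.+2 :=
  \row_j oapp (x 0) 0 (unlift i j).

Lemma face_row_simplex n (i : 'I_n.+2) (x : std_simplex n) :
  face_row i (set_val x) \in std_simplex n.+1.
Proof.
case: x => x /= xP; have [x0 x1] := set_mem xP; apply/mem_set; split=> [j|].
  by rewrite mxE; case: (unlift i j).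
rewrite (bigD1_ord i)//= mxE unlift_none /= add0r -x1.
by apply: eq_bigr => j _; rewrite mxE liftK.
Qed.

Lemma continuous_face_row n (i : 'I_n.+2) : continuous (@face_row n i).
Proof.
move=> x A [P /= Px PA]; exists (fun k j => P k (fintype.lift i j)) => [k j|y yP] /=.
  by have := Px k (fintype.lift i j); rewrite mxE liftK (ord1 k).
apply: PA => k j; rewrite (ord1 k) mxE; case: unliftP => [l ->|ji] /=.
  exact: yP.
by have := Px 0 j; rewrite mxE ji unlift_none => /nbhs_singleton.
Qed.

Definition coface n (i : 'I_n.+2) (x : std_simplex n) : std_simplex n.+1 :=
  exist _ (face_row i (set_val x)) (face_row_simplex i x).

Lemma continuous_coface n (i : 'I_n.+2) : continuous (@coface n i).
Proof.
apply: continuous_comp_initial => x.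
apply: (@continuous_comp _ _ _ set_val (face_row i)).
  exact: initial_continuous.
exact: continuous_face_row.
Qed.

Context (T : topologicalType).

Definition singular_simplex (n : nat) : Type :=
  set_type [set f : std_simplex n -> T | continuous f].

Lemma continuous_face n (i : 'I_n.+2) (f : singular_simplex n.+1) :
  (set_val f \o coface i) \in [set f : std_simplex n -> T | continuous f].
Proof.
apply/mem_set => x; apply: continuous_comp; first exact: continuous_coface.
by case: f => f fP; exact: (set_mem fP).
Qed.

Definition face n (i : 'I_n.+2) (f : singular_simplex n.+1) :
  singular_simplex n := exist _ (set_val f \o coface i) (continuous_face i f).

Definition boundary n :
    {freeg (singular_simplex n.+1) / R} -> {freeg (singular_simplex n) / R} :=
  fglift (fun f => \sum_(i < n.+2) (-1) ^+ i *: << face i f >>).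

Definition is_cycle1 (c : {freeg (singular_simplex 1) / R}) : Prop :=
  boundary c = 0.

Definition is_boundary1 (c : {freeg (singular_simplex 1) / R}) : Prop :=
  range (@boundary 1) c.

(* the classes of the cycles [b i] form a basis of [H_1] *)
Definition dim_H1 (g : nat) : Prop :=
  exists2 b : 'I_g -> {freeg (singular_simplex 1) / R},
    forall i, is_cycle1 (b i) &
    forall c, is_cycle1 c ->
      exists! a : {ffun 'I_g -> R}, is_boundary1 (c - \sum_i a i *: b i).

End SingularHomology.

Definition has_genus (R : realType) (Gamma : tropical_curve R) (g : nat) :=
  @dim_H1 R Gamma g.

(** * Divisors, rational functions, rank and gap sequences *)

Section Divisors.
Context {R : realType} {Gamma : tropical_curve R}.
Implicit Types (D E : {freeg Gamma}) (f : Gamma -> R) (p : Gamma).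

Definition effective D : Prop := forall p, 0 <= coeff p D.

Definition is_slope f p (nu : 'I_(valence p)) (k : int) : Prop :=
  \forall t \near 0^'+, f (branch nu t) = f p + k%:~R * t.

(* On a compact curve, being affine near every point along each tangent
   direction amounts to being piecewise affine with finitely many pieces. *)
Definition rational_function f : Prop :=
  continuous f /\ forall p (nu : 'I_(valence p)), exists k, is_slope f nu k.

Definition slope f p (nu : 'I_(valence p)) : int := xget 0 (is_slope f nu).

Definition is_div f D : Prop :=
  forall p, coeff p D = - \sum_(nu < valence p) slope f nu.

Definition lin_equiv D E : Prop :=
  exists2 f, rational_function f & is_div f (D - E).

Definition rank_at_least D (k : nat) : Prop :=
  forall s : k.-tuple Gamma,
    exists2 E, effective E & lin_equiv (D - \sum_(p <- s) << p >>) E.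

Definition rank_candidates D : set int :=
  [set k | k = -1 \/ exists2 m : nat, k = m%:Z & rank_at_least D m].

(* The default value of [xget] is never used: the set of candidates contains
   [-1] and is bounded above by [maxr (-1) (deg D)]. *)
Definition rank D : int :=
  xget (-1) [set k | rank_candidates D k /\ ubound (rank_candidates D) k].

Definition gaps D p : set int :=
  [set m | 0 < m /\ rank (D - << m *g p >>) < rank (D - << m - 1 *g p >>)].

(* increasing enumeration of the (finite) set of gaps *)
Definition gap_seq D p : seq int := sort <=%O (enum_fset (fset_set (gaps D p))).

Definition WL_ge (r : nat) D (n : 'I_r.+1 -> int) : set Gamma :=
  [set p | forall i, n i <= (gap_seq D p)`_i].

End Divisors.

Definition gap_poset (r : nat) (d : int) : set ('I_r.+1 -> int) :=
  [set n | [/\ 1 <= n ord0, {homo n : i j / (i < j)%N >-> i < j}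
             & n ord_max <= d + 1]].

Definition connected_components (T : topologicalType) (A : set T) :
  set (set T) := [set connected_component A x | x in A].

(* Main.v *)
Require Import Defs.
From HB Require Import structures.
From mathcomp Require Import all_boot all_order all_algebra.
From mathcomp Require Import all_classical all_reals all_analysis.
From mathcomp Require Import finmap freeg.
From mathcomp Require Import zify ring lra.

(** Idea.  The curve is cut into finitely many isometric closed segments with
    disjoint interiors.  A divisor given by chips at positions [t] on these
    segments is principal iff there are integer slopes [a], one per edge,
    satisfying a flow condition independent of [t], and such that the rises of
    the resulting piecewise affine profiles form the coboundary of a function
    on the vertices.  By an energy (summation by parts) argument only finitely
    many [a] occur, and being a coboundary is a linear condition; so the
    principal configurations form, in each chart, a finite union of compact
    polytopes.  Hence the locus where [D - m (p)] has rank at least [k], which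
    is obtained from these by one existential and one universal block of
    quantifiers, is closed (projections of compact sets, then intersections),
    and by elimination of quantifiers for linear inequalities its trace on each
    edge is a finite union of intervals.  Counting gaps, [WL_ge D n] is the
    intersection over [i] of the loci where the rank of [D - (n_i - 1)(p)] is
    at least [r - i], with [i] counted from [0]. *)

Set Implicit Arguments.
Unset Strict Implicit.
Unset Printing Implicit Defensive.

Import Order.TTheory GRing.Theory Num.Theory.
Import numFieldNormedType.Exports.

Local Open Scope classical_set_scope.
Local Open Scope ring_scope.

(** * Semilinear sets and quantifier elimination *)

(** Two facts make the rank condition finite dimensional. Principal divisors have degree 0, so the
    number of points of the effective divisor is fixed in advance. On one edge, a rational function
    is determined by its initial value, its initial integer slope and the chips on that edge. The
    slopes are bounded as follows. For fixed charts and weights, the slopes of two solutions differ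
    by a circulation [b], which is orthogonal to every coboundary. The rises differ on an edge [e]
    by [b e * len e] up to an error bounded in terms of the edge lengths, so a large [b] would make
    the pairing of [b] with the difference of rises positive. Chip positions do not enter the bound.
    Closedness and finiteness of components need separate arguments: a semilinear set need not be
    closed, and a closed set may have infinitely many components. Projection along compact fibres
    handles the existential block only. For closedness the universally quantified points are
    therefore frozen and an arbitrary intersection is taken at the end, whereas quantifier
    elimination must treat them as variables. *)

Section SemilinearSets.
Context {R : realFieldType}.
Implicit Types (l : (nat -> R) * R) (v w : nat -> R) (M : nat).

Definition aeval M l v : R := l.2 + \sum_(i < M) l.1 i * v i.

(** Membership may depend only on the signs of finitely many affine forms. The condition is
    symmetric in [v] and [w], so a complement keeps the list and an intersection concatenates two
    lists; no normal form of polyhedra is carried along. Vectors are sequences of which [aeval M]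
    reads the first [M] entries, so that eliminating a variable changes no type. *)
Definition semilinear_set M (S : set (nat -> R)) : Prop :=
  exists L : seq ((nat -> R) * R), forall v w,
    (forall l, l \in L -> Num.sg (aeval M l v) = Num.sg (aeval M l w)) ->
    S v -> S w.

Definition upd v M (t : R) : nat -> R := fun i => if i == M then t else v i.

Lemma aeval_upd M l v t : aeval M.+1 l (upd v M t) = aeval M l v + l.1 M * t.
Proof.
rewrite /aeval big_ord_recr /= addrA; congr (_ + _ + _); last first.
  by rewrite /upd eqxx.
by apply: eq_bigr => i _; rewrite /upd ltn_eqF.
Qed.

Lemma semilinearC M S : semilinear_set M S -> semilinear_set M (~` S).
Proof.
move=> [L LP]; exists L => v w vw nSv Sw; apply: nSv.
by apply: LP Sw => l lL; rewrite vw.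
Qed.

Lemma semilinearI M S S' :
  semilinear_set M S -> semilinear_set M S' -> semilinear_set M (S `&` S').
Proof.
move=> [L LP] [L' LP']; exists (L ++ L') => v w vw [Sv S'v]; split.
- by apply: LP Sv => l lL; apply: vw; rewrite mem_cat lL.
- by apply: LP' S'v => l lL; apply: vw; rewrite mem_cat lL orbT.
Qed.

Lemma semilinear_ext M (S S' : set (nat -> R)) :
  (forall v, S v <-> S' v) -> semilinear_set M S -> semilinear_set M S'.
Proof.
move=> SS' [L LP]; exists L => v w vw S'v.
by apply: (SS' w).1; apply: (LP v) => //; apply: (SS' v).2.
Qed.

Lemma semilinear_cst M (P : Prop) : semilinear_set M (fun=> P).
Proof. by exists [::]. Qed.

Lemma semilinear_bigcap M (T : eqType) (s : seq T) (S : T -> set (nat -> R)) :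
  (forall x, x \in s -> semilinear_set M (S x)) ->
  semilinear_set M (fun v => forall x, x \in s -> S x v).
Proof.
elim: s => [_|a s IH Ss].
  by apply: semilinear_ext (semilinear_cst M True).
have {}IH := IH (fun x xs => Ss x (mem_behead (s := a :: s) xs)).
apply: semilinear_ext (semilinearI (Ss a (mem_head _ _)) IH) => v.
split=> [[Sa Sv] x|Sv]; first by rewrite inE => /predU1P[->|/Sv].
by split=> [|x xs]; apply: Sv; rewrite inE ?eqxx// xs orbT.
Qed.

Lemma semilinear_bigcup M (T : eqType) (s : seq T) (S : T -> set (nat -> R)) :
  (forall x, x \in s -> semilinear_set M (S x)) ->
  semilinear_set M (fun v => exists2 x, x \in s & S x v).
Proof.
move=> Ss; have := semilinearC (semilinear_bigcap (fun x xs => semilinearC (Ss x xs))).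
apply: semilinear_ext => v; split=> [|[x xs Sx] /(_ x xs)//].
by move=> h; apply: contrapT => nh; apply: h => x xs Sx; apply: nh; exists x.
Qed.

Lemma semilinear_eq0 M l : semilinear_set M (fun v => aeval M l v = 0).
Proof.
exists [:: l] => v w /(_ l (mem_head _ _)) vw v0; apply/eqP.
by rewrite -sgr_eq0 -vw v0 sgr0.
Qed.

Lemma semilinear_ge0 M l : semilinear_set M (fun v => 0 <= aeval M l v).
Proof.
by exists [:: l] => v w /(_ l (mem_head _ _)) vw; rewrite -sgr_ge0 vw sgr_ge0.
Qed.

Lemma semilinear_imply M S S' :
  semilinear_set M S -> semilinear_set M S' -> semilinear_set M (fun v => S v -> S' v).
Proof.
move=> Ss /semilinearC S's; apply: semilinear_ext (semilinearC (semilinearI Ss S's)) => v.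
split=> [h Sv|h [Sv]]; last by apply; exact: h.
by apply: contrapT => nS'v; exact: h.
Qed.

Lemma semilinear_itv M i c : (i < M)%N -> semilinear_set M (fun v => 0 <= v i <= c).
Proof.
move=> iM; have sumE (b : R) v : \sum_(j < M) (if (j : nat) == i then b else 0) * v j = b * v i.
  rewrite (bigD1 (Ordinal iM))//= eqxx big1 ?addr0// => j.
  by rewrite -val_eqE /= => /negPf ->; rewrite mul0r.
apply: semilinear_ext (semilinearI
  (semilinear_ge0 M (fun j => if j == i then 1 else 0, 0))
  (semilinear_ge0 M (fun j => if j == i then -1 else 0, c))) => v.
rewrite /aeval /= !sumE mul1r add0r mulN1r subr_ge0.
by split=> [[-> ->]|/andP[-> ->]].
Qed.

Lemma seq_max (s : seq R) : s <> [::] ->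
  exists2 m, m \in s & forall x, x \in s -> x <= m.
Proof.
elim: s => // a [|b s] IH _.
  by exists a; rewrite ?inE// => x; rewrite inE => /eqP ->.
have [//|m ms mP] := IH; have [am|ma] := leP a m.
  exists m; first by rewrite inE ms orbT.
  by move=> x; rewrite inE => /predU1P[->//|/mP].
exists a; first by rewrite mem_head.
by move=> x; rewrite inE => /predU1P[->//|/mP xm]; rewrite (le_trans xm)// ltW.
Qed.

Lemma exists_between (lo hi : seq R) :
  (forall x y, x \in lo -> y \in hi -> x < y) ->
  exists t, (forall x, x \in lo -> x < t) /\ (forall y, y \in hi -> t < y).
Proof.
move=> lohi.
have maxP (s : seq R) : exists m, (forall x, x \in s -> x <= m) /\ (s <> [::] -> m \in s).
  by case: s => [|a s]; [exists 0|have [//|m ms mP] := @seq_max (a :: s); exists m].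
have [m [mP ms]] := maxP lo.
have [m' [m'P m's]] := maxP [seq - x | x <- hi].
have hiP y : y \in hi -> - m' <= y.
  by move=> yhi; rewrite lerNl m'P// map_f.
have [lo0|/eqP/ms mlo] := eqVneq lo [::].
  exists (- m' - 1); split=> [x|y /hiP]; first by rewrite lo0.
  by apply: lt_le_trans; lra.
have [hi0|hi0] := eqVneq hi [::].
  exists (m + 1); split=> [x /mP|y]; last by rewrite hi0.
  by move/le_lt_trans; apply; lra.
have /mapP[y yhi m'E] : m' \in [seq - x | x <- hi].
  by apply: m's; case: (hi) hi0.
have my := lohi _ _ mlo yhi.
exists ((m + y) / 2); split=> [x /mP xm|z /hiP]; first lra.
by rewrite m'E; lra.
Qed.

(** Either [t] is one of the [r i], or it separates those below it from those above it. The [r' i]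
    are ordered in the same way, so the corresponding place exists among them. *)
Lemma order_transfer (T : eqType) (L : seq T) (r r' : T -> R) :
  (forall i j, i \in L -> j \in L -> Num.sg (r i - r j) = Num.sg (r' i - r' j)) ->
  forall t, exists t', forall i, i \in L -> Num.sg (t - r i) = Num.sg (t' - r' i).
Proof.
move=> rr' t; have [/hasP[i iL /eqP ->]|/hasPn nt] := boolP (has (fun i => t == r i) L).
  by exists (r' i) => j jL; apply: rr'.
have [x y|t' [lo hi]] := @exists_between [seq r' i | i <- L & r i < t] [seq r' i | i <- L & t < r i].
  move=> /mapP[i]; rewrite mem_filter => /andP[it iL] ->.
  move=> /mapP[j]; rewrite mem_filter => /andP[jt jL] ->.
  by rewrite -subr_gt0 -sgr_gt0 -rr'// sgr_gt0 subr_gt0 (lt_trans it).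
exists t' => i iL; have := nt i iL; rewrite neq_lt => /orP[tr|tr].
  rewrite !ltr0_sg// subr_lt0//; apply: hi.
  by rewrite map_f// mem_filter tr.
rewrite !gtr0_sg// subr_gt0//; apply: lo.
by rewrite map_f// mem_filter tr.
Qed.

(* Quantifier elimination: whether some value of the last variable gives the
   forms prescribed signs depends only on the relative order of their roots. *)
Lemma semilinear_ex M S : semilinear_set M.+1 S ->
  semilinear_set M (fun v => exists t, S (upd v M t)).
Proof.
move=> [L LP].
pose rt l := ((fun i => - l.1 i / l.1 M), - l.2 / l.1 M).
pose sb l l' := ((fun i => l.1 i - l'.1 i), l.2 - l'.2).
have rtE l v : aeval M (rt l) v = - aeval M l v / l.1 M.
  rewrite /aeval /rt /= mulNr opprD mulrDl mulNr; congr (_ + _).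
  rewrite -sumrN mulr_suml; apply: eq_bigr => i _.
  by rewrite mulrAC -mulNr.
have sbE l l' v : aeval M (sb l l') v = aeval M l v - aeval M l' v.
  rewrite /aeval /sb /= opprD addrACA; congr (_ + _).
  by rewrite -sumrB; apply: eq_bigr => i _; rewrite mulrBl.
(* The differences record the order of the roots. [L] itself is kept for the forms in which the last
   variable has coefficient 0; for these [rt] is a harmless junk value. *)
exists (L ++ [seq sb (rt l) (rt l') | l <- L, l' <- L]) => v w vw [t St].
have [l l' lL l'L|t' t'P] := @order_transfer _ L (fun l => aeval M (rt l) v)
    (fun l => aeval M (rt l) w) _ t.
  by rewrite -!sbE vw// mem_cat; apply/orP; right; apply/allpairsP; exists (l, l').
exists t'; apply: LP St => l lL; rewrite !aeval_upd.
have [l0|l0] := eqVneq (l.1 M) 0.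
  by rewrite l0 !mul0r !addr0 vw// mem_cat lL.
have E u x : aeval M l u + l.1 M * x = l.1 M * (x - aeval M (rt l) u).
  by rewrite rtE; field.
by rewrite !E !sgrM t'P.
Qed.

(** All entries from [N] on are rebound at once. The block needs no upper end, because a semilinear
    set ignores the entries beyond its dimension. *)
Definition ex_from N S : set (nat -> R) :=
  fun v => exists2 v', (forall i, (i < N)%N -> v' i = v i) & S v'.

Definition all_from N S : set (nat -> R) :=
  fun v => forall v', (forall i, (i < N)%N -> v' i = v i) -> S v'.

Lemma semilinear_dep M S v w : semilinear_set M S ->
  (forall i, (i < M)%N -> v i = w i) -> S v -> S w.
Proof.
move=> [L LP] vw; apply: LP => l _; congr (Num.sg (_ + _)).
by apply: eq_bigr => i _; rewrite vw.
Qed.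

Lemma semilinear_ex_from M N S :
  semilinear_set (M + N) S -> semilinear_set M (ex_from M S).
Proof.
elim: N S => [|N IH] S sS.
  rewrite addn0 in sS; apply: semilinear_ext (sS) => v; split=> [Sv|[v' vv']].
    by exists v.
  exact: semilinear_dep vv'.
rewrite addnS in sS; apply: semilinear_ext (IH _ (semilinear_ex sS)) => v.
split=> [[v' vv' [t St]]|[v' vv' Sv']].
  exists (upd v' (M + N) t) => // i iM; rewrite /upd ltn_eqF ?vv'//.
  by rewrite (leq_trans iM)// leq_addr.
exists v' => //; exists (v' (M + N)%N).
apply: semilinear_dep sS _ Sv' => i _.
by rewrite /upd; case: eqP => // ->.
Qed.

Lemma semilinear_all_from M N S :
  semilinear_set (M + N) S -> semilinear_set M (all_from M S).
Proof.
move=> /semilinearC/semilinear_ex_from/semilinearC; apply: semilinear_ext => v.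
split=> [h v' vv'|h [v' vv' Sv']]; last exact: Sv' (h _ vv').
by apply: contrapT => nS; apply: h; exists v'.
Qed.

End SemilinearSets.

(** * Cutting a tropical curve into segments *)

Section Covering.
Context {R : realType} (T : metricType R).

Lemma open_mdistP (A : set T) :
  open A <-> forall x, A x -> exists2 e, 0 < e & forall y, mdist x y < e -> A y.
Proof.
rewrite openE; split=> [Ao x /Ao|h x /h [e e0 eA]].
  by move=> /nbhs_ballP[e /= e0 eA]; exists e => // y xy; apply: eA; rewrite ballEmdist.
by apply/nbhs_ballP; exists e => //= y; rewrite ballEmdist; apply: eA.
Qed.

Lemma finite_subcover (U : T -> set T) : compact [set: T] ->
  (forall x, open (U x)) -> (forall x, U x x) ->
  exists s : seq T, forall x, exists2 p, p \in s & U p x.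
Proof.
move=> cT Uo Ux; have [[x0 _]|T0] := pselect (exists x : T, True); last first.
  by exists [::] => x; case: T0; exists x.
pose PT : ptopologicalType := HB.pack (T : Type) T (isPointed.Build T x0).
have : @compact PT [set: T] by [].
rewrite compact_cover => /(_ T [set: T] U) [|x _|D _ DP]; first by [].
  by exists x => //; apply: Ux.
exists (enum_fset D) => x; have [//|p pD pU] := DP x.
by exists p.
Qed.

Lemma isometric_within_continuous (c : R -> T) (L : R) :
  (forall s t, 0 <= s <= L -> 0 <= t <= L -> mdist (c s) (c t) = `|s - t|) ->
  {within `[0, L], continuous c}.
Proof.
move=> iso; apply/subspace_continuousP => x /=; rewrite in_itv /= => x0L.
apply/metricType_numDomainType.cvgrPdist_lt => e e0.
apply/nbhs_ballP; exists e => //= y; rewrite /ball /= => xy; rewrite in_itv /= => y0L.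
by rewrite iso.
Qed.

End Covering.

Section Arcs.
Context {R : realType} (T : metricType R).

Definition arc : Type := ((R -> T) * R)%type.

HB.instance Definition _ := Choice.copy arc ((R -> T) * R)%type.

Implicit Types (a b : arc) (V : seq T) (l : seq arc).

Definition arc_interior a : set T := [set a.1 t | t in `]0, a.2[].

Definition arc_image a : set T := [set a.1 t | t in `[0, a.2]].

(** The last clause excludes branching inside the arc, which an isometric segment alone would allow.
    It is asked of every open subinterval so that subarcs inherit it. *)
Definition is_arc a : Prop :=
  [/\ 0 < a.2,
      forall s t, 0 <= s <= a.2 -> 0 <= t <= a.2 ->
        mdist (a.1 s) (a.1 t) = `|s - t|
    & forall s t, 0 <= s -> t <= a.2 -> open [set a.1 u | u in `]s, t[]].

Definition is_edge V a : Prop :=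
  [/\ is_arc a, a.1 0 \in V, a.1 a.2 \in V &
      forall t, 0 < t < a.2 -> a.1 t \notin V].

Definition subarc a (s u : R) : arc := (fun t => a.1 (s + t), u).

Lemma subarcP a s u : is_arc a -> 0 <= s -> 0 < u -> s + u <= a.2 ->
  is_arc (subarc a s u).
Proof.
move=> [a0 aiso ao] s0 u0 su; split=> //= [t t' tu t'u|t t' t0 t'u].
  by rewrite aiso; [congr `|_|; ring|lra|lra].
have -> : [set a.1 (s + x) | x in `]t, t'[] = [set a.1 x | x in `]s + t, s + t'[].
  apply/seteqP; split=> x /= [y]; rewrite in_itv /= => yt <-.
    by exists (s + y) => //; rewrite in_itv /=; lra.
  by exists (y - s); [rewrite in_itv /=; lra|congr (a.1 _); ring].
by apply: ao; lra.
Qed.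

Lemma arc_image_closed a : is_arc a -> closed (arc_image a).
Proof.
move=> [_ aiso _]; apply: compact_closed; first exact: metric_hausdorff.
exact: (continuous_compact (isometric_within_continuous aiso) (@segment_compact _ _ _)).
Qed.

Lemma arc_interior_connected a : is_arc a -> connected (arc_interior a).
Proof.
move=> [_ aiso _]; apply: connected_continuous_connected.
  exact/connected_intervalP/interval_is_interval.
apply: continuous_subspaceW (isometric_within_continuous aiso).
exact: subset_itv_oo_cc.
Qed.

Lemma arc_interior_open a : is_arc a -> open (arc_interior a).
Proof. by move=> [_ _ ao]; apply: ao. Qed.

Lemma arc_interior_image a : arc_interior a `<=` arc_image a.
Proof.
move=> x [t]; rewrite /= in_itv /= => /andP[t0 ta] <-; exists t => //=.
by rewrite in_itv /= !ltW.
Qed.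

Lemma edge_interior V a x : is_edge V a -> arc_interior a x -> x \notin V.
Proof. by move=> [_ _ _ aV] [t /=]; rewrite in_itv /= => /aV + <-. Qed.

Lemma edge_image V a x : is_edge V a -> arc_image a x -> x \notin V ->
  arc_interior a x.
Proof.
move=> [_ a0 a1 aV] [t /=]; rewrite in_itv /= => /andP[].
rewrite le_eqVlt => /predU1P[<-|t0]; first by move=> _ <-; rewrite a0.
rewrite le_eqVlt => /predU1P[->|ta]; first by move=> <-; rewrite a1.
by move=> <- _; exists t => //=; rewrite in_itv /= t0.
Qed.

(* The interior of [a] is both open and closed in the complement of [V]. *)
Lemma edge_interior_sub V a b : is_edge V a -> is_edge V b ->
  arc_interior a `&` arc_interior b !=set0 -> arc_interior b `<=` arc_interior a.
Proof.
move=> ea eb [x [ax bx]].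
have [aa _ _ _] := ea; have [ab _ _ _] := eb.
have <- : arc_interior b `&` arc_interior a = arc_interior b; last by move=> ? [].
apply: (arc_interior_connected ab).
- by exists x.
- by exists (arc_interior a) => //; apply: arc_interior_open.
- exists (arc_image a); first exact: arc_image_closed.
  apply/seteqP; split=> y [by_ ay]; split=> //; first exact: arc_interior_image.
  by apply: (edge_image ea ay); apply: edge_interior eb by_.
Qed.

Lemma arc_image_sub a b : is_arc a -> is_arc b ->
  arc_interior a `<=` arc_interior b -> arc_image a `<=` arc_image b.
Proof.
move=> aa ab ab_sub x [t /= + <-]; rewrite in_itv /= => ta.
have [a0 aiso _] := aa.
have /closure_id -> := arc_image_closed ab.
move=> U /nbhs_ballP[e /= e0 eU].
have [u [u0 ute]] : exists u, 0 < u < a.2 /\ `|t - u| < e.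
  have [ta2|at2] := leP t (a.2 / 2).
    exists (t + Num.min e a.2 / 4).
    have [ea|ae] := leP e a.2; split; rewrite ?ltr_distl; lra.
  exists (t - Num.min e a.2 / 4).
  have [ea|ae] := leP e a.2; split; rewrite ?ltr_distl; lra.
exists (a.1 u); split.
  by apply/arc_interior_image/ab_sub; exists u => //=; rewrite in_itv.
by apply: eU; rewrite ballEmdist /= aiso//; lra.
Qed.

(** Induction on the number of points of [V] in the interior: after a cut at one of them, that point
    is interior to neither half. The claim [sub1] treats both halves at once. *)
Lemma cut_arc V a : is_arc a -> a.1 0 \in V -> a.1 a.2 \in V ->
  exists2 l : seq arc, (forall b, b \in l -> is_edge V b) &
    forall x, arc_image a x -> exists2 b, b \in l & arc_image b x.
Proof.
have [n] := ubnP (count (fun v => `[< arc_interior a v >]) (undup V)).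
elim: n a => // n IH a; rewrite ltnS => an aa a0 a1.
have [aiV|/forallNP aiV] := pselect (exists t, 0 < t < a.2 /\ a.1 t \in V); last first.
  exists [:: a] => [b|x ax]; last by exists a; rewrite ?mem_head.
  rewrite inE => /eqP ->; split=> // t ta.
  by apply/negP => atV; apply: (aiV t).
have [t [/andP[t0 ta] tV]] := aiV.
have [apos aiso _] := aa.
have sub1 s u : 0 <= s -> 0 < u -> s + u <= a.2 -> (s = t \/ s + u = t) ->
    a.1 s \in V -> a.1 (s + u) \in V ->
  exists2 l : seq arc, (forall b, b \in l -> is_edge V b) &
    forall x, arc_image (subarc a s u) x -> exists2 b, b \in l & arc_image b x.
  move=> s0 u0 su st sV uV; apply: IH => /=; rewrite ?addr0//; last exact: subarcP.
  apply: leq_trans an; rewrite -!size_filter.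
  apply: (@uniq_leq_size _ (a.1 t :: _)) => [|x].
    rewrite /= filter_uniq ?undup_uniq// andbT mem_filter negb_and.
    apply/orP; left; apply/asboolPn => -[y /=]; rewrite in_itv /= => yu.
    have yE : mdist (a.1 (s + y)) (a.1 t) = `|s + y - t| by apply: aiso; lra.
    move=> ayt; move: yE; rewrite ayt mdistxx => /esym/normr0_eq0; lra.
  rewrite inE mem_filter => /predU1P[->|].
    rewrite mem_filter mem_undup tV andbT; apply/asboolP.
    by exists t => //=; rewrite in_itv /= t0.
  move=> /andP[/asboolP[y /=]]; rewrite in_itv /= => yu <- syV.
  rewrite mem_filter syV andbT; apply/asboolP.
  by exists (s + y) => //=; rewrite in_itv /=; lra.
have [l1 l1P l1C] := sub1 0 t (lexx 0) t0 ltac:(lra) ltac:(lra) a0 ltac:(by rewrite add0r).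
have tE : t + (a.2 - t) = a.2 by ring.
have [l2 l2P l2C] := sub1 t (a.2 - t) (ltW t0) ltac:(lra) ltac:(lra) ltac:(lra) tV
  ltac:(by rewrite tE).
exists (l1 ++ l2) => [b|x [y /=]]; first by rewrite mem_cat => /orP[/l1P|/l2P].
rewrite in_itv /= => ya <-; have [yt|ty] := leP y t.
  have [|b bl bx] := l1C (a.1 y).
    by exists y; rewrite /= ?in_itv /= ?add0r//; lra.
  by exists b; rewrite // mem_cat bl.
have [|b bl bx] := l2C (a.1 y).
  by exists (y - t); rewrite /= ?in_itv /=; [lra|congr (a.1 _); ring].
by exists b; rewrite // mem_cat bl orbT.
Qed.

(** Edges whose interiors meet have the same image, but may be parametrised in opposite directions.
    Equality of arcs is therefore obtained by keeping one representative of each. *)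
Lemma disjoint_edges V l : (forall a, a \in l -> is_edge V a) ->
  exists l' : seq arc, [/\ uniq l', forall a, a \in l' -> is_edge V a,
    forall a b, a \in l' -> b \in l' ->
      arc_interior a `&` arc_interior b !=set0 -> a = b
    & forall a, a \in l -> exists2 b, b \in l' & arc_image a `<=` arc_image b].
Proof.
elim: l => [_|a l IH al]; first by exists [::].
have [|l' [ul l'e l'd l'c]] := IH; first by move=> b bl; apply: al; rewrite inE bl orbT.
have ae : is_edge V a by apply: al; rewrite mem_head.
have [[b [bl ab]]|nab] :=
    pselect (exists b, b \in l' /\ arc_interior a `&` arc_interior b !=set0).
  exists l'; split=> // c; rewrite inE => /predU1P[->|/l'c//].
  have be := l'e _ bl; exists b => //.
  have [aa _ _ _] := ae; have [abb _ _ _] := be.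
  by apply: (arc_image_sub aa abb); apply: (edge_interior_sub be ae); rewrite setIC.
have nab' b : b \in l' -> ~ (arc_interior a `&` arc_interior b !=set0).
  by move=> bl ab; apply: nab; exists b.
exists (a :: l'); split.
- rewrite /= ul andbT; apply/negP => /nab'; apply.
  have [[a0 _ _] _ _ _] := ae; exists (a.1 (a.2 / 2)).
  by split; exists (a.2 / 2) => //=; rewrite in_itv /=; lra.
- by move=> b; rewrite inE => /predU1P[->|/l'e].
- move=> b c; rewrite !inE => /predU1P[->|bl] /predU1P[->|cl] //.
  + by move/(nab' _ cl).
  + by rewrite setIC => /(nab' _ bl).
  + exact: l'd.
- move=> b; rewrite inE => /predU1P[->|/l'c[c cl bc]].
    by exists a; rewrite ?mem_head.
  by exists c => //; rewrite inE cl orbT.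
Qed.

End Arcs.

(** Closed edges are embedded isometrically, so there are no loops. In [gam_disjoint] the second
    parameter may be an end: an interior point of an edge lies on no other closed edge, and distinct
    edges meet at most in common ends. *)
Record model (R : realType) (T : metricType R) := Model {
  edges : nat;
  gam : 'I_edges -> R -> T;
  len : 'I_edges -> R;
  len_gt0 : forall e, 0 < len e;
  gam_isometry : forall e s t, 0 <= s <= len e -> 0 <= t <= len e ->
    mdist (gam e s) (gam e t) = `|s - t|;
  gam_cover : forall x, exists e t, 0 <= t <= len e /\ gam e t = x;
  gam_disjoint : forall e e' t t', 0 < t < len e -> 0 <= t' <= len e' ->
    gam e t = gam e' t' -> e = e'
}.

Section ModelOfCurve.
Context {R : realType} (Gamma : tropical_curve R).
Implicit Types (p x y : Gamma).

Lemma branch_open p (i : 'I_(valence p)) s t : 0 <= s -> t <= star_radius p ->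
  open [set branch i u | u in `]s, t[].
Proof.
move=> s0 tr; apply/open_mdistP => x [u /=]; rewrite in_itv /= => /andP[su ut] <-.
have [e e0 eU] : exists2 e, 0 < e & forall y, mdist (branch i u) y < e ->
    exists (i : 'I_(valence p)) t, 0 <= t < star_radius p /\ y = branch i t.
  by apply: (open_mdistP _).1 (star_open p) _ _; exists i, u; split=> //; lra.
exists (Num.min e (Num.min (u - s) (t - u))); first by rewrite !lt_min; lra.
move=> y; rewrite !lt_min => /andP[ye yst].
have [j [v [vr yE]]] := eU _ ye; move: yst; rewrite yE star_isometry//; last lra.
case: eqP => [<-|_ ?]; last by lra.
by rewrite !ltr_distlC => ?; exists v => //=; rewrite in_itv /=; lra.
Qed.

Lemma star_open_lt p r : r <= star_radius p ->
  open [set x | exists (i : 'I_(valence p)) t, 0 <= t < r /\ x = branch i t].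
Proof.
move=> rr; apply/open_mdistP => x [i [t [tr ->]]].
have [e e0 eU] : exists2 e, 0 < e & forall y, mdist (branch i t) y < e ->
    exists (i : 'I_(valence p)) t, 0 <= t < star_radius p /\ y = branch i t.
  by apply: (open_mdistP _).1 (star_open p) _ _; exists i, t; split=> //; lra.
exists (Num.min e (r - t)); first by rewrite lt_min; lra.
move=> y; rewrite lt_min => /andP[ye yrt].
have [j [v [vr yE]]] := eU _ ye; move: yrt; rewrite yE star_isometry//; last lra.
move=> vt; exists j, v; split=> //; move: vt.
by case: eqP => [_|_ ?]; rewrite ?ltr_distlC; lra.
Qed.

(** The radius is halved because an arc contains its far end, while the chart is controlled only for
    parameters strictly below [star_radius p]. *)
Lemma branch_arc p (i : 'I_(valence p)) : is_arc (branch i, star_radius p / 2).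
Proof.
have := star_radius_gt0 p; split=> /=; first by lra.
  by move=> s t sr tr; rewrite star_isometry ?eqxx//; lra.
by move=> s t s0 tr; apply: branch_open => //; lra.
Qed.

(** By compactness finitely many half-radius stars cover the curve. Their branches may overlap in
    any way; once all are cut at the ends of all, two pieces whose interiors meet have the same
    interior. *)
Lemma model_of_curve : exists M : model Gamma, True.
Proof.
have [||s sP] := finite_subcover (U := fun p => [set x | exists (i : 'I_(valence p)) t,
    0 <= t < star_radius p / 2 /\ x = branch i t]) (@curve_compact _ Gamma).
- by move=> p; apply: star_open_lt; have := star_radius_gt0 p; lra.
- move=> p; exists (Ordinal (valence_ge1 p)), 0; rewrite branch0; split=> //.
  by have := star_radius_gt0 p; lra.
pose A : seq (arc Gamma) :=
  flatten [seq [seq (@branch _ Gamma p i, star_radius p / 2) | i <- enum 'I_(valence p)] | p <- s].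
have AE a : a \in A -> exists p (i : 'I_(valence p)), a = (branch i, star_radius p / 2).
  by move/flatten_mapP => [p _ /mapP[i _ ->]]; exists p, i.
have Aarc a : a \in A -> is_arc a.
  by move=> /AE[p [i ->]]; apply: branch_arc.
have Acov x : exists2 a, a \in A & arc_image a x.
  have [p ps [i [t [tr ->]]]] := sP x.
  exists (branch i, star_radius p / 2).
    by apply/flatten_mapP; exists p => //; apply/mapP; exists i; rewrite ?mem_enum.
  by exists t => //=; rewrite in_itv /=; lra.
pose V : seq Gamma := [seq a.1 0 | a <- A] ++ [seq a.1 a.2 | a <- A].
have [B BV AB] : exists2 B : seq (arc Gamma), forall b, b \in B -> is_edge V b &
    forall a, a \in A -> forall x, arc_image a x -> exists2 b, b \in B & arc_image b x.
  (* The induction runs over a sublist of [A], while [V] keeps the ends of all the arcs of [A]. *)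
  have sub : {subset A <= A} by [].
  elim: {1 3}A sub => [_|a A' IH aA]; first by exists [::].
  have [b bA'|B BV BC] := IH; first by rewrite aA// inE bA' orbT.
  have aA' : a \in A by rewrite aA// mem_head.
  have [||C CV CC] := @cut_arc _ _ V a (Aarc _ aA').
  - by rewrite mem_cat; apply/orP; left; apply/mapP; exists a.
  - by rewrite mem_cat; apply/orP; right; apply/mapP; exists a.
  exists (C ++ B) => [b|b]; first by rewrite mem_cat => /orP[/CV|/BV].
  rewrite inE => /predU1P[->|bA'] x.
    by move=> /CC[c cC cx]; exists c; rewrite // mem_cat cC.
  by move=> /(BC _ bA')[c cB cx]; exists c; rewrite // mem_cat cB orbT.
have [E [uE EV Ed Ec]] := disjoint_edges BV.
have Eedge (e : 'I_(size E)) : is_edge V (tnth (in_tuple E) e).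
  by apply: EV; apply: mem_tnth.
unshelve eexists (@Model _ Gamma (size E) (fun e => (tnth (in_tuple E) e).1)
  (fun e => (tnth (in_tuple E) e).2) _ _ _ _) => //.
- by move=> e; have [[]] := Eedge e.
- by move=> e; have [[_ ? _] _ _ _] := Eedge e.
- move=> x; have [a aA ax] := Acov x; have [b bB bx] := AB _ aA _ ax.
  have [c cE bc] := Ec _ bB; have [t /= + <-] := bc _ bx; rewrite in_itv /= => tc.
  have /tnthP[e ec] : c \in in_tuple E by [].
  by exists e, t; rewrite -ec.
- move=> e e' t t' te te' tt'.
  have ex : arc_interior (tnth (in_tuple E) e) ((tnth (in_tuple E) e).1 t).
    by exists t => //=; rewrite in_itv.
  have e'x : arc_interior (tnth (in_tuple E) e') ((tnth (in_tuple E) e).1 t).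
    apply: edge_image (Eedge e') _ _; last exact: edge_interior (Eedge e) ex.
    by rewrite tt'; exists t' => //=; rewrite in_itv.
  have : tnth (in_tuple E) e = tnth (in_tuple E) e'.
    by apply: Ed; rewrite ?mem_tnth//; exists ((tnth (in_tuple E) e).1 t).
  by have /tuple_uniqP Einj : uniq (in_tuple E) := uE; move=> /Einj.
Qed.

End ModelOfCurve.

(** * Tangent directions and half-edges *)

Lemma near_right0P (R : realFieldType) (P : R -> Prop) :
  (\forall s \near 0^'+, P s) <-> exists2 e, 0 < e & forall s, 0 < s < e -> P s.
Proof.
split=> [/nbhs_ballP[e /= e0 eP]|[e e0 eP]].
  exists e => // s /andP[s0 se]; apply: eP => //=.
  by rewrite /ball /= sub0r normrN gtr0_norm.
near=> s; apply: eP; apply/andP; split; near: s.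
  exact: nbhs_right_gt.
exact: nbhs_right_lt.
Unshelve. all: by end_near. Qed.

Section HalfEdges.
Context {R : realType} {Gamma : tropical_curve R} (M : model Gamma).
Implicit Types (x : Gamma) (e : 'I_(edges M)) (h : 'I_(edges M) * bool) (t s : R).

(** A half-edge is an edge with a direction, [true] being that of increasing parameter. The
    condition says that there is room to move in this direction from the point at [t]; an interior
    point thus lies on both half-edges of its edge, an end on one. *)
Definition hpos h t : bool :=
  if h.2 then 0 <= t < len h.1 else 0 < t <= len h.1.

Definition hparam h t s : R := if h.2 then t + s else t - s.

Definition hmove h t s : Gamma := gam h.1 (hparam h t s).

Lemma hposW h t : hpos h t -> 0 <= t <= len h.1.
Proof. by rewrite /hpos; case: h.2; lra. Qed.

Lemma gam_inj e t s : 0 <= t <= len e -> 0 <= s <= len e ->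
  gam e t = gam e s -> t = s.
Proof.
move=> te se ts; have := gam_isometry te se.
by rewrite ts mdistxx => /esym/normr0_eq0/eqP; rewrite subr_eq0 => /eqP.
Qed.

Lemma hmove_range h t : hpos h t ->
  \forall s \near 0^'+, 0 < hparam h t s < len h.1.
Proof.
move=> ht; apply/near_right0P; exists (if h.2 then len h.1 - t else t).
  by move: ht; rewrite /hpos; case: h.2; lra.
by move=> s; move: ht; rewrite /hpos /hparam; case: h.2; lra.
Qed.

Lemma hmove_dist h t s u :
  0 <= hparam h t s <= len h.1 -> 0 <= hparam h t u <= len h.1 ->
  mdist (hmove h t s) (hmove h t u) = `|s - u|.
Proof.
move=> hs hu; rewrite gam_isometry// /hparam; case: h.2.
  by congr `|_|; ring.
by rewrite distrC; congr `|_|; ring.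
Qed.

Lemma hparam0 h t : hparam h t 0 = t.
Proof. by rewrite /hparam addr0 subr0 if_same. Qed.

Definition along x (nu : 'I_(valence x)) h t : Prop :=
  \forall s \near 0^'+, branch nu s = hmove h t s.

Lemma branch_inj x (i j : 'I_(valence x)) s : 0 < s < star_radius x ->
  branch i s = branch j s -> i = j.
Proof.
move=> sr ij; apply/eqP/negPn/negP => /negPf nij.
have := @star_isometry _ _ x i j s s; rewrite ij mdistxx nij => h.
by have := h ltac:(lra) ltac:(lra); lra.
Qed.

(** Close to the centre, every point of the half-edge lies on some branch. The branch cannot change
    with the distance: at distances [s] and [s1] on different branches the points would be [s + s1]
    apart, on the half-edge they are only [|s - s1|] apart. *)
Lemma along_exists h t : hpos h t ->
  exists nu : 'I_(valence (gam h.1 t)), along nu h t.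
Proof.
move=> ht; set x := gam h.1 t.
have r0 := star_radius_gt0 x.
have [d d0 dU] : exists2 d, 0 < d & forall y, mdist x y < d ->
    exists (i : 'I_(valence x)) t, 0 <= t < star_radius x /\ y = branch i t.
  apply: (open_mdistP _).1 (star_open x) _ _.
  by exists (Ordinal (valence_ge1 x)), 0; rewrite branch0; split=> //; lra.
have [e e0 eP] := (near_right0P _).1 (hmove_range ht).
have toBranch s : 0 < s < Num.min d e ->
    exists2 i : 'I_(valence x), s < star_radius x & hmove h t s = branch i s.
  rewrite lt_min => sde.
  have xs : mdist x (hmove h t s) = s.
    have := @hmove_dist h t 0 s; rewrite /hmove hparam0 sub0r normrN gtr0_norm; last lra.
    by apply; [exact: hposW|have := eP s; lra].
  have [|i [u [ur hu]]] := dU (hmove h t s); first by rewrite xs; lra.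
  have := @star_isometry _ _ x i i 0 u; rewrite branch0 eqxx sub0r normrN -hu xs.
  move=> su; have {}su : s = u by rewrite su ?ger0_norm//; lra.
  by exists i; [lra|rewrite hu su].
pose s1 := Num.min d e / 2.
have m0 : 0 < Num.min d e by rewrite lt_min d0.
have s1P : 0 < s1 < Num.min d e by rewrite /s1; lra.
have [i ir hi] := toBranch _ s1P.
exists i; apply/near_right0P; exists (Num.min d e) => //.
move=> s sde; have [j jr hj] := toBranch _ sde.
have [<-//|ij] := eqVneq j i.
have := @star_isometry _ _ x j i s s1; rewrite -hi -hj (negPf ij) hmove_dist.
- move=> H; have {}H := H ltac:(lra) ltac:(lra).
  have : `|s - s1| < s + s1 by rewrite ltr_distl; lra.
  by rewrite H ltxx.
- by have := eP s; move: sde; rewrite lt_min; lra.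
- by have := eP s1; move: s1P; rewrite lt_min; lra.
Qed.

Lemma along_inj x (i j : 'I_(valence x)) h t :
  along i h t -> along j h t -> i = j.
Proof.
move=> ih jh; near (0 : R)^'+ => s; apply: (@branch_inj x i j s).
  apply/andP; split; near: s; first exact: nbhs_right_gt.
  by apply: nbhs_right_lt; exact: star_radius_gt0.
by have -> : branch i s = hmove h t s; [near: s|apply/esym; near: s].
Unshelve. all: by end_near. Qed.

Lemma gam_image_closed e : closed [set gam e t | t in `[0, len e]].
Proof.
apply: compact_closed; first exact: metric_hausdorff.
exact: (continuous_compact (isometric_within_continuous (@gam_isometry _ _ M e))
  (@segment_compact _ _ _)).
Qed.

(** Edges are closed, so those missing [x] stay away from it ([avoid]). A nearby point of the branch
    hence lies on an edge through [x], and the side of [x] on which it falls gives the half-edge. *)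
Lemma branch_along x (nu : 'I_(valence x)) :
  exists h t, [/\ hpos h t, gam h.1 t = x & along nu h t].
Proof.
have avoid e : \forall s \near 0^'+,
    [set gam e t | t in `[0, len e]] (branch nu s) -> [set gam e t | t in `[0, len e]] x.
  have [xe|xe] := pselect ([set gam e t | t in `[0, len e]] x).
    by near=> s.
  have /open_mdistP/(_ x xe)[d d0 dU] := closed_openC (@gam_image_closed e).
  apply/near_right0P; exists (Num.min d (star_radius x)).
    by have := star_radius_gt0 x; rewrite lt_min; lra.
  move=> s; rewrite lt_min => sd; apply: contraPP => _; apply: dU.
  have := @star_isometry _ _ x nu nu 0 s; rewrite branch0 eqxx sub0r normrN.
  by move=> ->; rewrite ?gtr0_norm//; lra.
have near_h h : \forall s \near 0^'+, forall t, hpos h t -> gam h.1 t = x ->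
    exists2 nu' : 'I_(valence x), along nu' h t & branch nu' s = hmove h t s.
  have [[t [ht tx]]|nt] := pselect (exists t, hpos h t /\ gam h.1 t = x); last first.
    by near=> s => t ht tx; case: nt; exists t.
  have := along_exists ht; rewrite tx => -[nu' nu'h].
  near=> s => t' ht' t'x.
  have -> : t' = t by apply: (gam_inj (hposW ht') (hposW ht)); rewrite t'x.
  by exists nu' => //; near: s.
near (0 : R)^'+ => s.
have s0 : 0 < s by near: s; exact: nbhs_right_gt.
have sr : s < star_radius x.
  by near: s; apply: nbhs_right_lt; exact: star_radius_gt0.
have [e [u [ue eu]]] := gam_cover M (branch nu s).
have [t /= + tx] : [set gam e t | t in `[0, len e]] x.
  have : forall e, [set gam e t | t in `[0, len e]] (branch nu s) ->
      [set gam e t | t in `[0, len e]] x.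
    by near: s; apply: filter_forall.
  by apply; exists u => //=; rewrite in_itv.
rewrite in_itv /= => te.
have tus : `|t - u| = s.
  rewrite -(gam_isometry te ue) tx eu.
  have := @star_isometry _ _ x nu nu 0 s; rewrite branch0 eqxx sub0r normrN.
  by move=> ->; rewrite ?gtr0_norm//; lra.
pose h := (e, t <= u).
have ht : hpos h t.
  rewrite /hpos /=; case: (leP t u) tus => [tu|ut].
    by rewrite distrC ger0_norm; lra.
  by rewrite gtr0_norm; lra.
have hts : hmove h t s = branch nu s.
  rewrite -eu /hmove /hparam /=; congr (gam e _).
  move: tus; case: (leP t u) => [tu|ut].
    by rewrite distrC ger0_norm; lra.
  by rewrite gtr0_norm; lra.
exists h, t; split=> //.
(* The half-edge was read off at the single distance [s]. Some branch [nu'] follows it, and meeting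
   [nu] at distance [s] forces [nu' = nu]. *)
have [nu' nu'h] : exists2 nu' : 'I_(valence x), along nu' h t & branch nu' s = hmove h t s.
  have : forall h, forall t, hpos h t -> gam h.1 t = x ->
    exists2 nu' : 'I_(valence x), along nu' h t & branch nu' s = hmove h t s.
    by near: s; apply: filter_forall.
  exact.
by rewrite hts => /branch_inj <- //; lra.
Unshelve. all: by end_near. Qed.

Definition hat x h : bool := `[< exists t, hpos h t /\ gam h.1 t = x >].

Definition htime x h : R := xget 0 [set t | hpos h t /\ gam h.1 t = x].

Lemma hatP x h : hat x h -> hpos h (htime x h) /\ gam h.1 (htime x h) = x.
Proof. by move=> /asboolP[t tP]; exact: (@xgetPex _ 0 [set t | hpos h t /\ gam h.1 t = x] (ex_intro _ t tP)). Qed.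

Lemma htimeE x h t : hpos h t -> gam h.1 t = x -> hat x h /\ htime x h = t.
Proof.
move=> ht tx; have xh : hat x h by apply/asboolP; exists t.
split=> //; have [ht' tx'] := hatP xh.
by apply: (gam_inj (hposW ht') (hposW ht)); rewrite tx.
Qed.

Lemma hmove_disjoint h h' t t' : hpos h t -> hpos h' t' ->
  gam h.1 t = gam h'.1 t' ->
  (\forall s \near 0^'+, hmove h t s = hmove h' t' s) -> h = h'.
Proof.
move=> ht ht' tt' hh'.
have [s [s0 hs hs' ss']] : exists s, [/\ 0 < s, 0 < hparam h t s < len h.1,
    0 < hparam h' t' s < len h'.1 & hmove h t s = hmove h' t' s].
  near (0 : R)^'+ => s; exists s; split; near: s => //; first exact: nbhs_right_gt.
    exact: hmove_range.
  exact: hmove_range.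
have ee' : h.1 = h'.1 by apply: gam_disjoint ss' => //; lra.
case: h h' ht ht' tt' {hh'} hs hs' ss' ee' => [e b] [e' b'] /= ht ht' tt' hs hs' ss' ee'.
rewrite -{}ee' in ht' tt' hs' ss' *; congr (_, _).
have {tt'}tE := gam_inj (hposW ht) (hposW ht') tt'.
have : hparam (e, b) t s = hparam (e, b') t' s by apply: gam_inj ss'; lra.
by rewrite -tE /hparam /=; case: (b); case: (b') => //; lra.
Unshelve. all: by end_near. Qed.

(* The tangent directions at [x] are in bijection with the half-edges through [x]. *)
Lemma sum_directions (V : zmodType) x (F : 'I_(valence x) -> V)
    (G : 'I_(edges M) * bool -> V) :
  (forall nu h, hat x h -> along nu h (htime x h) -> F nu = G h) ->
  \sum_nu F nu = \sum_(h | hat x h) G h.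
Proof.
move=> FG.
have hP (nu : 'I_(valence x)) : exists h, hat x h /\ along nu h (htime x h).
  have [h [t [ht tx nuh]]] := branch_along nu; exists h.
  by have [xh ->] := htimeE ht tx.
pose hh nu := sval (cid (hP nu)).
have hhP nu : hat x (hh nu) /\ along nu (hh nu) (htime x (hh nu)).
  by rewrite /hh; case: cid.
have hh_inj : injective hh.
  move=> i j ij; have [_ hi] := hhP i; have [_ hj] := hhP j.
  by rewrite -ij in hj; exact: along_inj hi hj.
rewrite (eq_bigr (fun nu => G (hh nu))) => [|nu _]; last first.
  by have [? ?] := hhP nu; exact: FG.
rewrite (eq_bigl (mem [set: 'I_(valence x)]%SET)) => [|nu]; last by rewrite /= inE.
rewrite -(big_imset (h := hh)) /=; last by move=> i j _ _; exact: hh_inj.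
apply: eq_bigl => h; apply/imsetP/idP => [[nu _ ->]|xh]; first by have [] := hhP nu.
have [ht hx] := hatP xh.
have := along_exists ht; rewrite hx => -[nu nuh]; exists nu; rewrite ?inE//.
have [xh' nuh'] := hhP nu; have [ht' hx'] := hatP xh'.
apply: (hmove_disjoint ht ht'); first by rewrite hx hx'.
near=> s; have <- : branch nu s = hmove h (htime x h) s by near: s.
by near: s.
Unshelve. all: by end_near. Qed.

End HalfEdges.

(** Continuation from 0. At the supremum [m] of the interval of constancy the left slope vanishes,
    the balance of slopes transfers this to the right slope, and [G] stays constant a little beyond
    [m]. Both [kr] and [kl] are outgoing slopes, whence the sign in the balance. *)
Lemma const_on_segment (R : realType) (G kr kl : R -> R) (L : R) :
  (forall u, 0 <= u < L -> \forall s \near 0^'+, G (u + s) = G u + kr u * s) ->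
  (forall u, 0 < u <= L -> \forall s \near 0^'+, G (u - s) = G u + kl u * s) ->
  kr 0 = 0 -> (forall u, 0 < u < L -> kr u = - kl u) ->
  forall u, 0 <= u <= L -> G u = G 0.
Proof.
move=> Gr Gl kr0 krl u uL.
pose S : set R := [set m | 0 <= m <= L /\ forall v, 0 <= v <= m -> G v = G 0].
have S0 : S 0 by split=> [|v v0]; [lra|congr G; lra].
have Sub : has_sup S by split; [exists 0|exists L => m [/andP[]]].
pose m := sup S.
have m0 : 0 <= m by apply: ub_le_sup S0; case: Sub.
have mL : m <= L by apply: ge_sup => [|z [/andP[]]//]; exists 0.
have Gm v : 0 <= v < m -> G v = G 0.
  move=> /andP[v0 vm]; have [z [zL zG] vz] := sup_adherent (eps := m - v) ltac:(lra) Sub.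
  by apply: zG; rewrite v0 /=; move: vz; rewrite -/m; lra.
have [Gm0 klm] : G m = G 0 /\ (0 < m -> kl m = 0).
  have [mpos|] := ltP 0 m; last by move=> mle; split; [congr G; lra|lra].
  have /near_right0P[e e0 eG] := Gl m ltac:(lra).
  (* The left expansion at the two distances [d] and [d / 2] determines the two unknowns [G m] and
     [kl m]. *)
  pose d := Num.min e m / 2.
  have md : 0 < Num.min e m by rewrite lt_min e0.
  have me : Num.min e m <= e by rewrite ge_min lexx.
  have mm : Num.min e m <= m by rewrite ge_min lexx orbT.
  have := eG d ltac:(rewrite /d; lra); rewrite Gm; last by rewrite /d; lra.
  have := eG (d / 2) ltac:(rewrite /d; lra); rewrite Gm; last by rewrite /d; lra.
  move=> E1 E2; have d0 : d != 0 by rewrite /d; lra.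
  have kd : kl m * d = 0 by lra.
  have k0 : kl m = 0 by apply/eqP; move/eqP: kd; rewrite mulf_eq0 (negPf d0) orbF.
  by split=> //; rewrite E2 k0; ring.
have [mL'|Lm] := ltP m L; last first.
  have mE : m = L by lra.
  have [um|mu] := ltP u m; first by apply: Gm; lra.
  by have -> : u = m by lra.
have krm : kr m = 0.
  have [mpos|mle] := ltP 0 m; last by have -> : m = 0 by lra.
  by rewrite krl ?klm ?oppr0//; lra.
have /near_right0P[e e0 eG] := Gr m ltac:(lra).
have [d [d0 de dL]] : exists d, [/\ 0 < d, d < e & m + d <= L].
  exists (Num.min e (L - m) / 2).
  have h1 : 0 < Num.min e (L - m) by rewrite lt_min; lra.
  have h2 : Num.min e (L - m) <= e by rewrite ge_min lexx.
  have h3 : Num.min e (L - m) <= L - m by rewrite ge_min lexx orbT.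
  by split; lra.
have Sd : S (m + d).
  split=> [|v vmd]; first lra.
  have [vm|mv] := ltP v m; first by apply: Gm; lra.
  have [->//|vm] := eqVneq v m.
  have mv' : m < v by rewrite lt_neqAle eq_sym vm.
  have -> : v = m + (v - m) by lra.
  by rewrite eG; [rewrite krm Gm0; ring|lra].
have : m + d <= m by apply: ub_le_sup Sd; case: Sub.
by lra.
Qed.

Section Slopes.
Context {R : realType} {Gamma : tropical_curve R} (M : model Gamma).
Implicit Types (x : Gamma) (e : 'I_(edges M)) (h : 'I_(edges M) * bool) (f : Gamma -> R).

Definition hslope f h (u : R) (k : int) : Prop :=
  \forall s \near 0^'+, f (hmove h u s) = f (gam h.1 u) + k%:~R * s.

Lemma slope_unique f x (nu : 'I_(valence x)) k :
  is_slope f nu k -> slope f nu = k.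
Proof.
move=> fk; apply: xget_subset1 => // k1 k2 h1 h2.
have [s [s0 s1 s2]] : exists s : R, [/\ 0 < s,
    f (branch nu s) = f x + k1%:~R * s & f (branch nu s) = f x + k2%:~R * s].
  near (0 : R)^'+ => s; exists s; split; near: s => //; exact: nbhs_right_gt.
move: s1; rewrite s2 => /addrI/mulIf; rewrite gt_eqF// => /(_ isT) /intr_inj.
by [].
Unshelve. all: by end_near. Qed.

Lemma is_slope_along f x (nu : 'I_(valence x)) h u k :
  gam h.1 u = x -> along nu h u -> hslope f h u k -> is_slope f nu k.
Proof.
move=> hx nuh fk; rewrite /is_slope; near=> s.
have : f (hmove h u s) = f (gam h.1 u) + k%:~R * s by near: s.
by rewrite hx => <-; congr f; near: s.
Unshelve. all: by end_near. Qed.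

Lemma hslope_along f x (nu : 'I_(valence x)) h u k :
  gam h.1 u = x -> along nu h u -> is_slope f nu k -> hslope f h u k.
Proof.
move=> hx nuh fk; rewrite /hslope; near=> s.
rewrite hx; have <- : f (branch nu s) = f x + k%:~R * s by near: s.
by congr f; apply/esym; near: s.
Unshelve. all: by end_near. Qed.

(** A neighbourhood of [x] is made of finitely many branches, and along each of them [f] deviates
    from [f x] by at most [|k| * u] at a small distance [u]. *)
Lemma slopes_continuous f :
  (forall x (nu : 'I_(valence x)), exists k, is_slope f nu k) -> continuous f.
Proof.
move=> fs x; apply/cvgrPdist_lt => eps eps0.
have near_nu : \forall s \near 0^'+, forall nu : 'I_(valence x),
    forall u, 0 < u < s -> `|f x - f (branch nu u)| < eps.
  apply: filter_forall => nu; have [k /near_right0P[d d0 dk]] := fs x nu.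
  have K0 : 0 < `|k%:~R : R| + 1 by rewrite ltr_wpDl.
  apply/near_right0P; exists (Num.min d (eps / (`|k%:~R| + 1))).
    by rewrite lt_min d0 divr_gt0.
  move=> s; rewrite lt_min => /and3P[s0 sd se] u /andP[u0 us].
  rewrite dk; last by rewrite u0 (lt_trans us).
  rewrite opprD addrA subrr sub0r normrN normrM (gtr0_norm u0).
  apply: (@le_lt_trans _ _ ((`|k%:~R| + 1) * u)); first by rewrite ler_wpM2r ?ltW// ltrDl.
  by rewrite mulrC -ltr_pdivlMr// (lt_trans us).
have [d d0 dU] : exists2 d, 0 < d & forall y, mdist x y < d ->
    exists (i : 'I_(valence x)) t, 0 <= t < star_radius x /\ y = branch i t.
  apply: (open_mdistP _).1 (star_open x) _ _.
  exists (Ordinal (valence_ge1 x)), 0; rewrite branch0; split=> //.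
  by have := star_radius_gt0 x; lra.
have [s s0 sP] : exists2 s : R, 0 < s & forall nu : 'I_(valence x),
    forall u, 0 < u < s -> `|f x - f (branch nu u)| < eps.
  by near (0 : R)^'+ => s; exists s; near: s => //; exact: nbhs_right_gt.
apply/nbhs_ballP; exists (Num.min d s); first by rewrite /= lt_min d0.
move=> y; rewrite ballEmdist /= lt_min => /andP[yd ys].
have [i [u [ur yE]]] := dU _ yd.
have := @star_isometry _ _ x i i 0 u; rewrite branch0 eqxx sub0r normrN -yE => xy.
have {}xy : mdist x y = u by rewrite xy ?ger0_norm//; lra.
have [u0|u0] := eqVneq u 0; first by rewrite yE u0 branch0 subrr normr0.
have u_gt0 : 0 < u by rewrite lt_neqAle eq_sym u0; lra.
by rewrite yE; apply: sP; lra.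
Unshelve. all: by end_near. Qed.

Lemma hat_edge e u b : 0 <= u <= len e ->
  hat (gam e u) (e, b) = hpos (e, b) u.
Proof.
move=> ue; apply/idP/idP => [/hatP[ht]|hu]; last by apply/asboolP; exists u.
by move/(gam_inj (hposW ht) ue) <-.
Qed.

Lemma htime_edge e u b : hpos (e, b) u -> htime (gam e u) (e, b) = u.
Proof. by move=> hu; have [] := @htimeE _ _ _ (gam e u) (e, b) u hu erefl. Qed.

Lemma hat_interior e u h : 0 < u < len e -> hat (gam e u) h -> h.1 = e.
Proof. by move=> ue /hatP[ht hx]; apply/esym; apply: gam_disjoint ue (hposW ht) (esym hx). Qed.

Lemma sum_hat (V : zmodType) x (G : 'I_(edges M) * bool -> V) :
  \sum_(h | hat x h) G h =
  \sum_e ((if hat x (e, true) then G (e, true) else 0)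
        + (if hat x (e, false) then G (e, false) else 0)).
Proof.
rewrite big_mkcond /=.
rewrite (eq_bigr (fun p => if hat x (p.1, p.2) then G (p.1, p.2) else 0)); last by case.
rewrite -(pair_bigA _ (fun e b => if hat x (e, b) then G (e, b) else 0)) /=.
apply: eq_bigr => e _; rewrite (bigD1 true)//= (bigD1 false)//= big1 ?addr0//.
by case.
Qed.

Lemma sum_slopes f (K : 'I_(edges M) * bool -> R -> int) x :
  (forall h u, hpos h u -> hslope f h u (K h u)) ->
  \sum_nu @slope _ Gamma f x nu = \sum_(h | hat x h) K h (htime x h).
Proof.
move=> fK; apply: sum_directions => nu h xh nuh; have [ht hx] := hatP xh.
by apply: slope_unique; apply: is_slope_along hx nuh _; exact: fK.
Qed.

End Slopes.

(** * Principal divisors *)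

Section Chips.
Context {R : realType} {Gamma : tropical_curve R} (M : model Gamma).
Context {n : nat} (w : 'I_n -> int) (kap : 'I_n -> 'I_(edges M)).
Implicit Types (x : Gamma) (e : 'I_(edges M)) (h : 'I_(edges M) * bool)
  (f phi : Gamma -> R) (t : 'I_n -> R) (u : R) (a : 'I_(edges M) -> int).

Definition on_edges t : Prop := forall i, 0 <= t i <= len (kap i).

Definition chip_div t : {freeg Gamma / int} :=
  \sum_i << w i *g gam (kap i) (t i) >>.

Definition edge_weight e : int := \sum_(i | kap i == e) w i.

(* [a e] is the slope with which a function enters the edge [e], before it
   meets the chips placed at the tail of [e]. *)
Definition is_flow a : Prop := forall x,
  \sum_(e | gam e 0 == x) a e = \sum_(e | gam e (len e) == x) (a e - edge_weight e).

Definition profile (c : R) a t e u : R :=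
  c + (a e)%:~R * u - \sum_(i | kap i == e) (w i)%:~R * Num.max 0 (u - t i).

Definition rise a t e : R :=
  (a e)%:~R * len e - \sum_(i | kap i == e) (w i)%:~R * (len e - t i).

(** Outgoing slopes. A chip at [u] itself has been passed in the forward direction and not in the
    backward one, so at an interior point the two slopes add up to minus the weight there. *)
Definition profile_slope a t h u : int :=
  if h.2 then a h.1 - \sum_(i | (kap i == h.1) && (t i <= u)) w i
  else - (a h.1 - \sum_(i | (kap i == h.1) && (t i < u)) w i).

Lemma coeff_chip_div t x :
  coeff x (chip_div t) = \sum_(i | gam (kap i) (t i) == x) w i.
Proof.
rewrite /chip_div raddf_sum /= [RHS]big_mkcond; apply: eq_bigr => i _.
by rewrite coeffU; case: eqP => _; rewrite ?mulr1 ?mulr0.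
Qed.

Lemma profile0 c a t e : on_edges t -> profile c a t e 0 = c.
Proof.
move=> tE; rewrite /profile mulr0 addr0 big1 ?subr0// => i _.
by rewrite max_l ?mulr0//; have := tE i; lra.
Qed.

Lemma profile_len c a t e : on_edges t -> profile c a t e (len e) = c + rise a t e.
Proof.
move=> tE; rewrite /profile /rise addrA; congr (_ - _).
apply: eq_bigr => i /eqP <-; rewrite max_r//.
by have := tE i; lra.
Qed.

Lemma profile_slopeP c a t h u : \forall s \near 0^'+,
  profile c a t h.1 (hparam h u s) = profile c a t h.1 u + (profile_slope a t h u)%:~R * s.
Proof.
have near_i : \forall s \near 0^'+, forall i, Num.max 0 (hparam h u s - t i) =
    Num.max 0 (u - t i) + (if h.2 then (t i <= u)%R%:R else - (t i < u)%R%:R) * s.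
  apply: filter_forall => i; apply/near_right0P; rewrite /hparam; case: h.2.
    have [tu|ut] := leP (t i) u.
      by exists 1 => // s s0; rewrite !max_r ?mulNr ?mul1r; lra.
    exists (t i - u); first lra.
    by move=> s su; rewrite !max_l ?mulNr ?mul0r; lra.
  have [tu|ut] := ltP (t i) u.
    exists (u - t i); first lra.
    by move=> s su; rewrite !max_r ?mulNr ?mul1r; lra.
  by exists 1 => // s s0; rewrite !max_l ?mulNr ?mul0r; lra.
near=> s.
have E : forall i, Num.max 0 (hparam h u s - t i) =
    Num.max 0 (u - t i) + (if h.2 then (t i <= u)%R%:R else - (t i < u)%R%:R) * s.
  by near: s.
rewrite /profile (eq_bigr (fun i => (w i)%:~R * Num.max 0 (u - t i) +
    (if h.2 then (w i)%:~R * (t i <= u)%R%:R else - ((w i)%:~R * (t i < u)%R%:R)) * s)); last first.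
  by move=> i _; rewrite E mulrDr mulrA; case: h.2; rewrite // mulrN.
have sumQ (Q : pred 'I_n) : \sum_(i | kap i == h.1) (w i)%:~R * (Q i)%:R =
    (\sum_(i | (kap i == h.1) && Q i) w i)%:~R :> R.
  rewrite rmorph_sum /= big_mkcondr; apply: eq_bigr => i _.
  by case: (Q i); rewrite ?mulr1 ?mulr0.
rewrite big_split /= -mulr_suml opprD.
rewrite /profile_slope /hparam; case: h.2.
  by rewrite sumQ intrB; ring.
by rewrite sumrN sumQ intrN intrB; ring.
Unshelve. all: by end_near. Qed.

Lemma is_slope_profile f phi a t : on_edges t ->
  (forall e u, 0 <= u <= len e -> f (gam e u) = profile (phi (gam e 0)) a t e u) ->
  forall h u, hpos h u -> hslope f h u (profile_slope a t h u).
Proof.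
move=> tE fE h u hu; rewrite /hslope; near=> s.
have hs : 0 < hparam h u s < len h.1 by near: s; exact: hmove_range.
rewrite /hmove !fE; [|exact: hposW|lra].
by near: s; exact: profile_slopeP.
Unshelve. all: by end_near. Qed.

(** Edge by edge. At an interior point the two slopes leave only the chips there. At a tail the
    slope is [a e] less the chips at the tail. At a head the chips lying there complete the sum to
    [edge_weight e]. Chips at ends are thereby absorbed, and the bracket no longer involves [t]. *)
Lemma sum_profile_slope a t x : on_edges t ->
  \sum_(h | hat x h) profile_slope a t h (htime x h) = - coeff x (chip_div t)
    + (\sum_(e | gam e 0 == x) a e - \sum_(e | gam e (len e) == x) (a e - edge_weight e)).
Proof.
move=> tE; rewrite sum_hat coeff_chip_div.
rewrite (partition_big kap xpredT) //= -sumrN.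
rewrite [X in _ + (X - _)]big_mkcond [X in _ + (_ - X)]big_mkcond /=.
rewrite -sumrB -big_split /=; apply: eq_bigr => e _.
have lenE := len_gt0 e.
have [[u [ue xE]]|nx] := pselect (exists u, 0 <= u <= len e /\ gam e u = x); last first.
  have nhat b : hat x (e, b) = false.
    by apply/negP => /hatP[ht hx]; apply: nx; exists (htime x (e, b)); rewrite (hposW ht).
  rewrite !nhat !ifF; first last.
  - by apply/eqP => h; apply: nx; exists 0; rewrite lexx ltW.
  - by apply/eqP => h; apply: nx; exists (len e); rewrite lexx ltW.
  rewrite big_pred0 ?subr0 ?addr0 ?oppr0// => i; apply/andP => -[/eqP ti /eqP ei].
  by apply: nx; exists (t i); rewrite -ei; split; [exact: tE|].
rewrite -xE !hat_edge// /hpos /=.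
have gE v : 0 <= v <= len e -> (gam e v == gam e u) = (v == u).
  by move=> ve; apply/eqP/eqP => [|->//]; exact: gam_inj.
rewrite !gE ?lexx ?(ltW lenE)//.
rewrite (eq_bigl (fun i => (kap i == e) && (t i == u))); last first.
  move=> i; rewrite andbC; have [ei|//] := eqVneq (kap i) e.
  by rewrite ei gE// -ei; exact: tE.
have [u0|u0] := eqVneq 0 u.
  rewrite -u0 lexx lenE /= htime_edge /hpos /= ?lexx ?lenE//.
  rewrite gt_eqF//= ltxx /= /profile_slope /=.
  rewrite (eq_bigl (fun i => (kap i == e) && (t i == 0))
    (P1 := fun i => (kap i == e) && (t i <= 0))); first by ring.
  move=> i; have [ei|//] := eqVneq (kap i) e.
  by rewrite /= eq_le; have /andP[-> _] := tE i; rewrite andbT.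
have upos : 0 < u by rewrite lt_neqAle u0; lra.
rewrite upos; have [lu|lu] := eqVneq (len e) u.
  rewrite -lu ltxx andbF /= lexx htime_edge /hpos /= ?lexx ?lenE//.
  rewrite /profile_slope /=.
  have -> : edge_weight e = \sum_(i | (kap i == e) && (t i < len e)) w i +
      \sum_(i | (kap i == e) && (t i == len e)) w i.
    rewrite /edge_weight (bigID (fun i => t i < len e)) /=; congr (_ + _).
    apply: eq_bigl => i; have [ei|//] := eqVneq (kap i) e.
    by rewrite -leNgt /= eq_le; have := tE i; rewrite ei => /andP[_ ->].
  by ring.
have ul : u < len e by rewrite lt_neqAle eq_sym lu; lra.
rewrite ul /= (ltW ul) (ltW upos) /= !htime_edge /hpos /= ?upos ?ul ?ltW//.
rewrite /profile_slope /=.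
have -> : \sum_(i | (kap i == e) && (t i <= u)) w i =
    \sum_(i | (kap i == e) && (t i < u)) w i + \sum_(i | (kap i == e) && (t i == u)) w i.
  rewrite (bigID (fun i => t i < u)) /=.
  by congr (_ + _); apply: eq_bigl => i; rewrite -andbA; congr (_ && _); case: ltgtP.
by ring.
Qed.

Lemma flow_coeff f phi a t : on_edges t ->
  (forall e u, 0 <= u <= len e -> f (gam e u) = profile (phi (gam e 0)) a t e u) ->
  is_div f (chip_div t) <-> is_flow a.
Proof.
move=> tE fE.
have E x := sum_slopes x (is_slope_profile tE fE).
split=> [fD x|aF x]; first move: (fD x); rewrite E sum_profile_slope//.
  by move=> D; lia.
by rewrite aF; ring.
Qed.

Lemma principal_exists a phi t : on_edges t -> is_flow a ->
  (forall e, phi (gam e (len e)) - phi (gam e 0) = rise a t e) ->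
  exists2 f, rational_function f & is_div f (chip_div t).
Proof.
move=> tE aF phiE.
have coverP x : exists eu : 'I_(edges M) * R, 0 <= eu.2 <= len eu.1 /\ gam eu.1 eu.2 = x :> Gamma.
  by have [e [u uP]] := gam_cover M x; exists (e, u).
pose c x := sval (cid (coverP x)).
have cP x : 0 <= (c x).2 <= len (c x).1 /\ gam (c x).1 (c x).2 = x.
  by rewrite /c; case: cid.
pose f x := profile (phi (gam (c x).1 0)) a t (c x).1 (c x).2.
(* At ends of edges the profile equals [phi], so [f] does not depend on the edge chosen through a
   vertex. *)
have ends e u : 0 <= u <= len e -> ~~ (0 < u < len e) ->
    profile (phi (gam e 0)) a t e u = phi (gam e u).
  move=> ue nu; have [->|u0] := eqVneq u 0; first by rewrite profile0.
  have [->|ul] := eqVneq u (len e); first by rewrite profile_len// -phiE; ring.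
  by move: nu; rewrite !lt_neqAle eq_sym u0 ul /= ue.
have fE e u : 0 <= u <= len e -> f (gam e u) = profile (phi (gam e 0)) a t e u.
  move=> ue; rewrite /f; have := cP (gam e u); case: (c _) => e' u' /= [u'e' gE].
  have [uI|uI] := boolP (0 < u < len e).
    have eE : e = e' by apply: gam_disjoint uI u'e' (esym gE).
    rewrite -{}eE in u'e' gE *.
    by have -> : u' = u by apply: gam_inj gE.
  rewrite (ends _ _ ue uI); have [u'I|u'I] := boolP (0 < u' < len e').
    have eE : e' = e by apply: gam_disjoint u'I ue gE.
    rewrite {}eE in u'e' gE u'I *.
    by have uu : u' = u by [apply: gam_inj gE]; rewrite -uu u'I in uI.
  by rewrite ends// gE.
exists f; last exact: (flow_coeff tE fE).2.
have fs x (nu : 'I_(valence x)) : exists k, is_slope f nu k.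
  have [h [u [hu hx nuh]]] := branch_along M nu.
  exists (profile_slope a t h u); apply: is_slope_along hx nuh _.
  exact: (is_slope_profile tE fE).
by split=> //; exact: slopes_continuous.
Qed.

(** On each edge [f] is compared with the profile having the same initial value and slope. Both bend
    by the same chips in the interior, so their difference has balanced slopes and is constant. *)
Lemma principal_flow f t : on_edges t -> rational_function f ->
  is_div f (chip_div t) ->
  exists2 a, is_flow a & forall e, f (gam e (len e)) - f (gam e 0) = rise a t e.
Proof.
move=> tE [_ fs] fD.
have hs (h : 'I_(edges M) * bool) u : exists k, hpos h u -> hslope f h u k.
  have [hu|] := boolP (hpos h u); last by exists 0.
  have [nu nuh] := along_exists hu; have [k nuk] := fs _ nu.
  by exists k => _; exact: hslope_along nuh nuk.
pose K h u := sval (cid (hs h u)).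
have KP h u : hpos h u -> hslope f h u (K h u) by rewrite /K; case: cid.
(* The outgoing slope at the tail is already lowered by the chips there; adding them back gives the
   slope before these chips. *)
pose a e := K (e, true) 0 + \sum_(i | (kap i == e) && (t i <= 0)) w i.
have fE e u : 0 <= u <= len e -> f (gam e u) = profile (f (gam e 0)) a t e u.
  move=> ue; have lenE := len_gt0 e.
  pose G u := f (gam e u) - profile (f (gam e 0)) a t e u.
  have GK b v : hpos (e, b) v -> \forall s \near 0^'+,
      G (hparam (e, b) v s) = G v + (K (e, b) v - profile_slope a t (e, b) v)%:~R * s.
    move=> hv; near=> s.
    have fE : f (hmove (e, b) v s) = f (gam e v) + (K (e, b) v)%:~R * s.
      by near: s; exact: KP.
    have pE : profile (f (gam e 0)) a t e (hparam (e, b) v s) =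
        profile (f (gam e 0)) a t e v + (profile_slope a t (e, b) v)%:~R * s.
      by near: s; exact: (profile_slopeP _ _ _ (e, b)).
    by rewrite /G pE -/(hmove (e, b) v s) fE intrB; ring.
  suff : G u = G 0 by rewrite /G profile0// subrr => /eqP; rewrite subr_eq0 => /eqP.
  apply: (@const_on_segment _ G
    (fun v => (K (e, true) v - profile_slope a t (e, true) v)%:~R)
    (fun v => (K (e, false) v - profile_slope a t (e, false) v)%:~R) (len e)) => //.
  - by move=> v ve; exact: (GK true).
  - by move=> v ve; exact: (GK false).
  - by rewrite /profile_slope /a /= addrK subrr.
  - move=> v ve; rewrite -intrN; congr (_%:~R).
    have hv b : hpos (e, b) v by rewrite /hpos /=; case: b; lra.
    have sE (G' : 'I_(edges M) * bool -> R -> int) :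
        \sum_(h | hat (gam e v) h) G' h (htime (gam e v) h) = G' (e, true) v + G' (e, false) v.
      rewrite sum_hat (bigD1 e)//= big1 ?addr0 => [|e' e'e].
        by rewrite !hat_edge ?hv ?htime_edge//; lra.
      have nh b : hat (gam e v) (e', b) = false.
        by apply/negP => /(hat_interior ve) /= /eqP; rewrite (negPf e'e).
      by rewrite !nh addr0.
    have := sum_profile_slope a (gam e v) tE; rewrite sE.
    have := fD (gam e v); rewrite (sum_slopes _ KP) sE => ->.
    have nend e' v' : 0 <= v' <= len e' -> ~~ (0 < v' < len e') ->
        (gam e' v' == gam e v) = false.
      move=> ve' nv'; apply/eqP => vv'.
      have ee' := gam_disjoint ve ve' (esym vv'); rewrite -{}ee' in ve' nv' vv' *.
      have vE : v' = v by apply: gam_inj vv' => //; lra.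
      by rewrite vE ve in nv'.
    have lenP e' := len_gt0 e'.
    rewrite !big_pred0; first by lia.
      by move=> e'; apply: nend; rewrite ?lexx ?ltxx ?andbF ?(ltW (lenP _)).
    by move=> e'; apply: nend; rewrite ?lexx ?ltxx ?(ltW (lenP _)).
exists a; first exact: (flow_coeff tE fE).1.
by move=> e; rewrite fE ?profile_len ?lexx ?ltW ?len_gt0//; ring.
Unshelve. all: by end_near. Qed.

End Chips.

(** * Coboundaries and summation by parts *)

Section Gradients.
Context {R : realType} {Gamma : tropical_curve R} (M : model Gamma).
Implicit Types (x : Gamma) (e : 'I_(edges M)) (phi : Gamma -> R) (y z : 'I_(edges M) -> R).

Definition endpoints : seq Gamma :=
  undup ([seq gam e 0 | e <- enum 'I_(edges M)] ++ [seq gam e (len e) | e <- enum 'I_(edges M)]).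

Lemma tail_endpoint e : gam e 0 \in endpoints.
Proof. by rewrite mem_undup mem_cat; apply/orP; left; apply/mapP; exists e; rewrite ?mem_enum. Qed.

Lemma head_endpoint e : gam e (len e) \in endpoints.
Proof. by rewrite mem_undup mem_cat; apply/orP; right; apply/mapP; exists e; rewrite ?mem_enum. Qed.

(** [phi] is a function on the whole curve, so that a rational function can itself be the
    witness. *)
Definition is_gradient y : Prop :=
  exists phi, forall e, phi (gam e (len e)) - phi (gam e 0) = y e.

Lemma sum_endpoints phi (g : 'I_(edges M) -> Gamma) y :
  (forall e, g e \in endpoints) ->
  \sum_(x <- endpoints) phi x * (\sum_(e | g e == x) y e) = \sum_e phi (g e) * y e.
Proof.
move=> gU; under eq_bigr => x _ do rewrite mulr_sumr.
rewrite (exchange_big_dep xpredT) //=; apply: eq_bigr => e _.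
rewrite big_mkcond (bigD1_seq (g e)) ?undup_uniq//= eqxx big1 ?addr0// => x.
by rewrite eq_sym => /negPf ->.
Qed.

(** Both sums are regrouped by vertices. Tails and heads carry different families because a flow
    loses [edge_weight] along each edge; for circulations [y] and [z] coincide. *)
Lemma stokes phi y z :
  (forall x, \sum_(e | gam e 0 == x) y e = \sum_(e | gam e (len e) == x) z e) ->
  \sum_e phi (gam e 0) * y e = \sum_e phi (gam e (len e)) * z e.
Proof.
move=> yz; rewrite -(sum_endpoints phi (g := fun e : 'I_(edges M) => gam e 0)); last exact: tail_endpoint.
rewrite -(sum_endpoints phi (g := fun e : 'I_(edges M) => gam e (len e))); last exact: head_endpoint.
by apply: eq_bigr => x _; rewrite yz.
Qed.

(** Gradients form the row space of the signed incidence matrix [N], which the columns of its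
    cokernel cut out. *)
Lemma gradient_linear : exists C : 'I_(edges M) -> 'I_(edges M) -> R,
  forall y, is_gradient y <-> forall j, \sum_e y e * C e j = 0.
Proof.
pose U := in_tuple endpoints.
pose N : 'M[R]_(size endpoints, edges M) := \matrix_(i, e)
  ((tnth U i == gam e (len e))%:R - (tnth U i == gam e 0)%:R).
exists (cokermx N) => y.
have cE j : (\row_e y e *m cokermx N) 0 j = \sum_e y e * cokermx N e j.
  by rewrite mxE; apply: eq_bigr => e _; rewrite mxE.
have -> : (forall j, \sum_e y e * cokermx N e j = 0) <-> (\row_e y e <= N)%MS.
  rewrite submxE; split=> [h|/eqP h j]; last by rewrite -cE h mxE.
  by apply/eqP/rowP => j; rewrite cE h mxE.
have mulN (r : 'rV[R]_(size endpoints)) e : (r *m N) 0 e =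
    \sum_i r 0 i * (tnth U i == gam e (len e))%:R - \sum_i r 0 i * (tnth U i == gam e 0)%:R.
  by rewrite mxE -sumrB; apply: eq_bigr => i _; rewrite mxE mulrBr.
split=> [[phi phiE]|/submxP[r rE]]; last first.
  exists (fun x => \sum_i r 0 i * (tnth U i == x)%:R) => e.
  by rewrite -mulN -rE mxE.
have phiU x : x \in endpoints -> \sum_i phi (tnth U i) * (tnth U i == x)%:R = phi x.
  move=> xU; have /tnthP[i ->] : x \in U by [].
  rewrite (bigD1 i)//= eqxx mulr1 big1 ?addr0// => j ji.
  have /tuple_uniqP Uinj : uniq U by exact: undup_uniq.
  by rewrite (negPf (contra_neq (@Uinj j i) ji)) mulr0.
apply/submxP; exists (\row_i phi (tnth U i)); apply/rowP => e.
rewrite mulN !mxE -phiE.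
rewrite -(phiU _ (head_endpoint e)) -(phiU _ (tail_endpoint e)).
by congr (_ - _); apply: eq_bigr => i _; rewrite mxE.
Qed.

End Gradients.

(** * Energy and the bound on slopes *)

Section Flows.
Context {R : realType} {Gamma : tropical_curve R} (M : model Gamma).
Context {n : nat} (w : 'I_n -> int) (kap : 'I_n -> 'I_(edges M)).
Implicit Types (x : Gamma) (e : 'I_(edges M)) (phi : Gamma -> R) (t : 'I_n -> R)
  (a : 'I_(edges M) -> int).

Definition principal (D : {freeg Gamma / int}) : Prop :=
  exists2 f, rational_function f & is_div f D.

Lemma principalP t : on_edges kap t ->
  principal (chip_div w kap t) <-> exists2 a, is_flow w kap a & is_gradient (rise w kap a t).
Proof.
move=> tE; split=> [[f fr fd]|[a aF [phi phiE]]].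
  by have [a aF aE] := principal_flow tE fr fd; exists a => //; exists f.
exact: principal_exists tE aF phiE.
Qed.

Lemma flow_weight a : is_flow w kap a -> \sum_i w i = 0.
Proof.
move=> aF; have := @stokes _ _ M (fun=> 1) (fun e => (a e)%:~R)
  (fun e => (a e - edge_weight w kap e)%:~R) _.
rewrite -!mulr_sumr !mul1r -!rmorph_sum /= => /(_ _)/intr_inj H.
have {}H : \sum_e a e = \sum_e (a e - edge_weight w kap e).
  by apply: H => x; rewrite -!rmorph_sum /= aF.
have -> : \sum_i w i = \sum_e edge_weight w kap e by rewrite (partition_big kap xpredT).
by move: H; rewrite sumrB -[LHS]subr0 => /addrI/oppr_inj.
Qed.

(** In [a - a'] the edge weights cancel, so it is a circulation, and summation by parts makes it
    orthogonal to the gradient of [phi - phi']. *)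
Lemma flow_energy a a' t t' : is_flow w kap a -> is_flow w kap a' ->
  is_gradient (rise w kap a t) -> is_gradient (rise w kap a' t') ->
  \sum_e (a e - a' e)%:~R * (rise w kap a t e - rise w kap a' t' e) = 0.
Proof.
move=> aF a'F [phi phiE] [phi' phi'E].
pose b e : R := (a e - a' e)%:~R.
have bF x : \sum_(e | gam e 0 == x) b e = \sum_(e | gam e (len e) == x) b e.
  rewrite -!rmorph_sum /=; congr (_%:~R); rewrite sumrB aF a'F -sumrB.
  by apply: eq_bigr => e _; ring.
have := stokes (fun x => phi x - phi' x) bF => E.
rewrite (eq_bigr (fun e => (phi (gam e (len e)) - phi' (gam e (len e))) * b e
  - (phi (gam e 0) - phi' (gam e 0)) * b e)); last first.
  by move=> e _; rewrite -phiE -phi'E -/(b e); ring.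
by rewrite sumrB E subrr.
Qed.

(** With [b = a - a'] the rises differ by [b e * len e + d e], where [|d e| <= K] since chips stay
    on their edges. Completing the square bounds each energy term below by [- K ^+ 2 / len e]; as
    the terms sum to 0, each is at most [S]. *)
Lemma flow_bound : exists B : nat, forall a a' t t',
  is_flow w kap a -> is_flow w kap a' -> on_edges kap t -> on_edges kap t' ->
  is_gradient (rise w kap a t) -> is_gradient (rise w kap a' t') ->
  forall e, `|a e - a' e| <= B%:Z.
Proof.
pose K : R := \sum_i `|(w i)%:~R| * len (kap i).
have K0 : 0 <= K.
  by apply: sumr_ge0 => i _; rewrite mulr_ge0// ltW// len_gt0.
pose S := \sum_(e < edges M) K ^+ 2 / len e.
have S0 : 0 <= S.
  by apply: sumr_ge0 => i _; rewrite divr_ge0 ?sqr_ge0// ltW// len_gt0.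
(* The sum over all edges dominates the bound [(S + K) / len e] of each. *)
exists (\sum_(e < edges M) (Num.truncn ((S + K) / len e)%R).+1)%N.
move=> a a' t t' aF a'F tE t'E ae ae' e0.
pose b e : R := (a e - a' e)%:~R.
pose d e := \sum_(i | kap i == e) (w i)%:~R * (t i - t' i).
have riseE e : rise w kap a t e - rise w kap a' t' e = b e * len e + d e.
  have -> : d e = \sum_(i | kap i == e) (w i)%:~R * (len e - t' i) -
      \sum_(i | kap i == e) (w i)%:~R * (len e - t i).
    by rewrite -sumrB; apply: eq_bigr => i _; ring.
  by rewrite /rise /b intrB; ring.
have dK e : `|d e| <= K.
  apply: le_trans (ler_norm_sum _ _ _) _.
  rewrite /K [leRHS](bigID (fun i => kap i == e)) /= -[leLHS]addr0 lerD//; last first.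
    by apply: sumr_ge0 => i _; rewrite mulr_ge0// ltW// len_gt0.
  apply: ler_sum => i _; rewrite normrM ler_wpM2l//.
  by rewrite ler_norml; have := tE i; have := t'E i; lra.
have E : \sum_e (b e * (b e * len e + d e)) = 0.
  by rewrite -[RHS](flow_energy aF a'F ae ae'); apply: eq_bigr => e _; rewrite riseE.
have term_ge e : - (K ^+ 2 / len e) <= b e * (b e * len e + d e).
  have le := len_gt0 e; rewrite -subr_ge0 opprK -(pmulr_lge0 _ le) mulrDl divfK ?gt_eqF//.
  have : (d e) ^+ 2 <= K ^+ 2 by rewrite -[(d e) ^+ 2]real_normK ?num_real// lerXn2r ?nnegrE.
  have := sqr_ge0 (b e * len e + d e / 2); have := sqr_ge0 (d e).
  by rewrite !expr2; lra.
have le := len_gt0 e0.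
have be0 : b e0 * (b e0 * len e0 + d e0) <= S.
  have := E; rewrite (bigD1 e0)//=.
  have : \sum_(i | i != e0) - (K ^+ 2 / len i) <=
      \sum_(i | i != e0) b i * (b i * len i + d i) by apply: ler_sum.
  have : 0 <= K ^+ 2 / len e0 by rewrite divr_ge0 ?sqr_ge0// ltW.
  rewrite sumrN => h1 h2 h3; rewrite /S (bigD1 e0)//=; lra.
have [->|ab] := eqVneq (a e0 - a' e0) 0; first by rewrite normr0.
(* Integrality enters here: a nonzero slope difference is at least 1, so
   [b ^ 2 * len <= S + |b| * K] may be divided by [|b|], leaving [|b| * len <= S + K]. *)
have b1 : 1 <= `|b e0|.
  by rewrite /b -intr_norm -[1]/(1%:~R) ler_int; move: ab; lia.
have bSK : `|b e0| <= (S + K) / len e0.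
  rewrite ler_pdivlMr//.
  have bd : `|b e0 * d e0| <= `|b e0| * K by rewrite normrM ler_wpM2l.
  have bb : b e0 * (b e0 * len e0) = `|b e0| * (`|b e0| * len e0).
    by rewrite !mulrA -!expr2 real_normK ?num_real.
  have : `|b e0| * (`|b e0| * len e0) <= `|b e0| * (S + K).
    move: be0; rewrite mulrDr bb; move: bd; rewrite ler_norml => /andP[h _] h'.
    have : S <= `|b e0| * S by rewrite ler_peMl.
    by lra.
  by rewrite ler_pM2l//; lra.
rewrite -(ler_int R) intr_norm -/(b e0).
have /ltW := le_lt_trans bSK (truncnS_gt _).
move=> /le_trans; apply; rewrite -pmulrn ler_nat.
by rewrite (bigD1 e0)//= leq_addr.
Qed.

End Flows.

(** * Linear description of principal configurations *)

Section Configurations.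
Context {R : realType} {Gamma : tropical_curve R} (M : model Gamma).
Context {n : nat} (w : 'I_n -> int) (kap : 'I_n -> 'I_(edges M)).

(** Only differences of flows are bounded, so one solution [a0] is fixed as a reference, if there is
    any. The candidates are then [a0] shifted on each edge by an integer between [-B] and [B],
    encoded by an ordinal. *)
Lemma finite_flows : exists As : seq ('I_(edges M) -> int), forall t : 'I_n -> R,
  on_edges kap t -> principal (chip_div w kap t) <->
    exists2 a, a \in As & is_gradient (rise w kap a t).
Proof.
have [[a0 [t0 [t0E a0F a0E]]]|none] := pselect (exists a0, exists t0 : 'I_n -> R,
    [/\ on_edges kap t0, is_flow w kap a0 & is_gradient (rise w kap a0 t0)]); last first.
  exists [::] => t tE; split=> [/(principalP _ tE)[a aF aE]|[]//].
  by case: none; exists a, t.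
have [B BP] := flow_bound w kap.
pose shift (c : {ffun 'I_(edges M) -> 'I_(B + B).+1}) : 'I_(edges M) -> int :=
  fun e => a0 e + (c e : nat)%:Z - B%:Z.
exists [seq a <- [seq shift c | c <- enum {ffun 'I_(edges M) -> 'I_(B + B).+1}] |
  `[< is_flow w kap a >]] => t tE.
split=> [/(principalP _ tE)[a aF aE]|[a]]; last first.
  by rewrite mem_filter => /andP[/asboolP aF _] aE; apply/(principalP _ tE); exists a.
exists a => //; rewrite mem_filter; apply/andP; split; first exact/asboolP.
have aB := BP _ _ _ _ aF a0F tE t0E aE a0E.
apply/mapP; exists [ffun e => inord (absz (a e - a0 e + B%:Z))]; rewrite ?mem_enum//.
apply/funext => e; rewrite /shift ffunE inordK; have := aB e; lia.
Qed.

(** [rise] is affine in [t], and [a] enters its constant term only: the affine subspaces found are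
    parallel. *)
Lemma principal_linear : exists L : seq (('I_(edges M) -> R) * ('I_(edges M) -> 'I_n -> R)),
  forall t, on_edges kap t -> principal (chip_div w kap t) <->
    exists2 l, l \in L & forall j, l.1 j + \sum_i l.2 j i * t i = 0.
Proof.
have [As AsP] := finite_flows; have [C CP] := gradient_linear M.
pose form (a : 'I_(edges M) -> int) : ('I_(edges M) -> R) * ('I_(edges M) -> 'I_n -> R) :=
  (fun j => \sum_e rise w kap a (fun=> 0) e * C e j, fun j i => (w i)%:~R * C (kap i) j).
have riseE a t j : (form a).1 j + \sum_i (form a).2 j i * t i = \sum_e rise w kap a t e * C e j.
  rewrite /= [X in _ + X](partition_big kap xpredT)//= -big_split /=.
  apply: eq_bigr => e _.
  rewrite (eq_bigr (fun i => ((w i)%:~R * t i) * C e j)); last first.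
    by move=> i /eqP ->; ring.
  rewrite -mulr_suml -mulrDl; congr (_ * _); rewrite /rise.
  rewrite (eq_bigr (fun i => (w i)%:~R * len e)); last by move=> i _; rewrite subr0.
  rewrite [in RHS](eq_bigr (fun i => (w i)%:~R * len e - (w i)%:~R * t i)); last first.
    by move=> i _; ring.
  by rewrite sumrB; ring.
exists [seq form a | a <- As] => t tE; split=> [/(AsP _ tE)[a aAs /CP aE]|].
  exists (form a); first by apply/mapP; exists a.
  by move=> j; rewrite riseE.
move=> [l /mapP[a aAs ->] aE]; apply/(AsP _ tE); exists a => //.
by apply/CP => j; rewrite -riseE.
Qed.

Lemma semilinear_principal : semilinear_set n (fun v : nat -> R =>
  on_edges kap (fun i => v i) /\ principal (chip_div w kap (fun i => v i))).
Proof.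
have [L LP] := principal_linear.
pose ext (c : 'I_n -> R) (k : nat) : R := if insub k is Some i then c i else 0.
have extE c (v : nat -> R) : \sum_(i < n) ext c i * v i = \sum_i c i * v i.
  by apply: eq_bigr => i _; rewrite /ext valK.
have on_edgesE : semilinear_set n (fun v : nat -> R => on_edges kap (fun i => v i)).
  apply: (@semilinear_ext _ _ (fun v => forall i : 'I_n, i \in enum 'I_n ->
      0 <= v i <= len (kap i))) => [v|].
    by split=> [h i|h i _]; [apply: h; rewrite mem_enum|exact: h].
  by apply: semilinear_bigcap => i _; exact: semilinear_itv.
have lin : semilinear_set n (fun v : nat -> R => exists2 l, l \in L &
    forall j, j \in enum 'I_(edges M) -> aeval n (ext (l.2 j), l.1 j) v = 0).
  by apply: semilinear_bigcup => l _; apply: semilinear_bigcap => j _; exact: semilinear_eq0.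
apply: semilinear_ext (semilinearI on_edgesE lin) => v.
split=> [[vE [l lL lE]]|[vE /(LP _ vE)[l lL lE]]]; split=> //.
  apply/(LP _ vE); exists l => // j; rewrite -extE.
  by apply: lE; rewrite mem_enum.
by exists l => // j _; rewrite /aeval /= extE.
Qed.

End Configurations.

(** * Compactness of principal configurations *)

Section Compactness.
Context {R : realType} {Gamma : tropical_curve R} (M : model Gamma).
Context {n : nat} (w : 'I_n -> int) (kap : 'I_n -> 'I_(edges M)).

Lemma linear_form_continuous (b : R) (c : 'I_n -> R) :
  continuous (fun v : 'rV[R]_n => b + \sum_i c i * v 0 i).
Proof.
have sumC : continuous (fun v : 'rV[R]_n => \sum_i c i * v 0 i).
  apply: continuous_big; first exact: add_continuous.
  move=> i _ v.
  apply: (@continuousM _ _ (fun=> c i) (fun v : 'rV[R]_n => v 0 i)); first exact: cst_continuous.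
  exact: coord_continuous.
move=> v; apply: (@continuousD _ _ _ (fun=> b)); first exact: cst_continuous.
exact: sumC.
Qed.

(** A general box, instead of the full product of edges, lets a chip be pinned by taking
    [lo i = hi i]. *)
Lemma principal_box_compact (lo hi : 'I_n -> R) :
  (forall i, 0 <= lo i /\ hi i <= len (kap i)) ->
  compact [set v : 'rV[R]_n | (forall i, lo i <= v 0 i <= hi i) /\
     principal (chip_div w kap (fun i => v 0 i))].
Proof.
move=> lohi; have [L LP] := principal_linear w kap.
rewrite (_ : mkset _ = [set v : 'rV[R]_n | forall i, `[lo i, hi i]%classic (v ord0 i)] `&`
  \bigcup_(l in [set` L]) \bigcap_(j in setT)
    [set v : 'rV[R]_n | l.1 j + \sum_i l.2 j i * v 0 i = 0]).
  apply: compact_closedI; first by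
    apply: (@rV_compact R n (fun i => `[lo i, hi i]%classic)) => i; exact: segment_compact.
  apply: closed_bigcup; first exact: finite_seq.
  move=> l _; apply: closed_bigI => j _.
  apply: (@preimage_closed _ _ (fun v : 'rV[R]_n => l.1 j + \sum_i l.2 j i * v 0 i) [set x | x = 0]).
    by move=> v _; exact: linear_form_continuous.
  exact: closed_eq.
have boxE (v : 'rV[R]_n) : (forall i, lo i <= v 0 i <= hi i) ->
    on_edges kap (fun i => v 0 i).
  by move=> vb i; have := vb i; have := lohi i; lra.
apply/seteqP; split=> v.
  move=> [vb /(LP _ (boxE _ vb))[l lL lE]]; split=> [i|].
    by rewrite /= in_itv /= vb.
  by exists l => // j _; exact: lE.
move=> [vb [l lL lE]].
have {}vb i : lo i <= v 0 i <= hi i by have := vb i; rewrite /= in_itv.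
split=> //; apply/(LP _ (boxE _ vb)); exists l => // j; exact: lE.
Qed.

Lemma gam_image_compact (K : set 'rV[R]_n) (i : 'I_n) :
  (forall v, K v -> 0 <= v 0 i <= len (kap i)) -> compact K ->
  compact [set gam (kap i) (v 0 i) | v in K].
Proof.
move=> Ki; apply: continuous_compact.
apply/subspace_continuousP => x Kx.
apply/metricType_numDomainType.cvgrPdist_lt => eps eps0.
have : nbhs x (fun y : 'rV[R]_n => `|x 0 i - y 0 i| < eps).
  have : (fun v : 'rV[R]_n => v 0 i) y @[y --> x] --> x 0 i by exact: coord_continuous.
  by move/cvgrPdist_lt; apply.
rewrite near_withinE; apply: filterS => y xy Ky.
by rewrite gam_isometry//; apply: Ki.
Qed.

End Compactness.

(** * Effective classes and rank loci *)

(** The four blocks of a configuration: the support of [D], the point [p], the [k] subtracted points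
    and the [r] points of the effective divisor. *)
Lemma index_cases (s k r : nat) (P : nat -> Prop) :
  (forall i, (i < s)%N -> P i) -> P s -> (forall j, (j < k)%N -> P (s.+1 + j)%N) ->
  (forall j, (j < r)%N -> P (s.+1 + k + j)%N) -> forall i, (i < s + (1 + (k + r)))%N -> P i.
Proof.
move=> P1 P2 P3 P4 i iN; have [/P1//|] := ltnP i s; rewrite leq_eqVlt => /predU1P[<-//|si].
have [ik|ki] := ltnP i (s.+1 + k).
  by rewrite -(subnKC si); apply: P3; lia.
by rewrite -(subnKC ki); apply: P4; move: iN; lia.
Qed.

Section NthBlocks.
Context (s k : nat) (T : Type) (x0 : T) (A B C : seq T) (b : T).
Context (sA : size A = s) (sB : size B = k).

Lemma nth_D i : (i < s)%N -> nth x0 (A ++ b :: B ++ C) i = nth x0 A i.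
Proof. by move=> si; rewrite nth_cat sA si. Qed.

Lemma nth_p : nth x0 (A ++ b :: B ++ C) s = b.
Proof. by rewrite nth_cat sA ltnn subnn. Qed.

Lemma nth_q j : (j < k)%N -> nth x0 (A ++ b :: B ++ C) (s.+1 + j) = nth x0 B j.
Proof.
move=> jk; rewrite nth_cat sA ltnNge addSnnS leq_addr /= addKn /= nth_cat sB jk.
by [].
Qed.

Lemma nth_x j : nth x0 (A ++ b :: B ++ C) (s.+1 + k + j) = nth x0 C j.
Proof.
rewrite nth_cat sA ltnNge addSn addSnnS -addnA leq_addr /= addKn addnS /= nth_cat sB.
by rewrite ltnNge leq_addr /= addKn.
Qed.

End NthBlocks.

Section EffectiveClasses.
Context {R : realType} {Gamma : tropical_curve R} (M : model Gamma).
Implicit Types (D E : {freeg Gamma / int}) (p : Gamma) (v : nat -> R).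

Lemma chart_exists p : exists c : 'I_(edges M) * R, 0 <= c.2 <= len c.1 /\ gam c.1 c.2 = p.
Proof. by have [e [u uP]] := gam_cover M p; exists (e, u). Qed.

Definition chart p : 'I_(edges M) * R := sval (cid (chart_exists p)).

Lemma chart_range p : 0 <= (chart p).2 <= len (chart p).1.
Proof. by rewrite /chart; case: cid => c []. Qed.

Lemma gam_chart p : gam (chart p).1 (chart p).2 = p.
Proof. by rewrite /chart; case: cid => c []. Qed.

(** [D] is the configuration of its own support, to which [flow_weight] applies. *)
Lemma deg_principal D : principal D -> deg D = 0.
Proof.
move=> Dp; have [->|D0] := eqVneq D 0; first exact: deg0.
have [y0 _] := @curve_nonempty _ Gamma.
pose y (i : 'I_(size (dom D))) := nth y0 (dom D) i.
pose w i := coeff (y i) D.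
have DE : D = chip_div w (fun i => (chart (y i)).1) (fun i => (chart (y i)).2).
  rewrite -[LHS]freeg_sumE (big_nth y0) big_mkord /chip_div.
  by apply: eq_bigr => i _; rewrite gam_chart.
have yE : on_edges (fun i => (chart (y i)).1) (fun i => (chart (y i)).2).
  by move=> i; exact: chart_range.
move: Dp; rewrite DE => /(principalP _ yE)[a /flow_weight w0 _].
by rewrite /chip_div raddf_sum /= -[RHS]w0; apply: eq_bigr => i _; rewrite degU.
Qed.

Lemma effectiveP E : effective E -> exists xs : seq Gamma, E = \sum_(x <- xs) << x >>.
Proof.
move=> Eeff; exists (flatten [seq nseq (absz (coeff z E)) z | z <- dom E]).
rewrite big_flatten big_map -[LHS]freeg_sumE; apply: eq_bigr => z _.
rewrite big_nseq iter_addr addr0 freegU_muln natz gez0_abs//.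
Qed.

Lemma effective_sum (xs : seq Gamma) : effective (\sum_(x <- xs) << x >>).
Proof.
move=> z; rewrite raddf_sum /=; apply: sumr_ge0 => x _.
by rewrite coeffU mul1r; case: (x == z).
Qed.

Lemma deg_sum_points (xs : seq Gamma) : deg (\sum_(x <- xs) << x >>) = (size xs)%:Z.
Proof.
rewrite raddf_sum /= (eq_bigr (fun=> 1)) => [|x _]; last by rewrite degU.
by rewrite big_const_seq count_predT iter_addr addr0 natz.
Qed.

Context (D : {freeg Gamma / int}) (m k r : nat).
Context (degD : deg D = (m + k + r)%:Z).
Let ys := dom D.
Let s := size ys.
Let n := (s + (1 + (k + r)))%N.

Let wl : seq int := [seq coeff y D | y <- ys] ++ (- m%:Z) :: nseq k (-1) ++ nseq r (-1).

(* The chips of a configuration: the points of [D], then [p], then the [q_j],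
   then the points of an effective divisor in the class of
   [D - m (p) - \sum (q_j)]; the charts of the latter ones are free. *)
Definition config_edges (e : 'I_(edges M)) (kq kx : seq 'I_(edges M)) : 'I_n -> 'I_(edges M) :=
  fun i => nth e ([seq (chart y).1 | y <- ys] ++ e :: kq ++ kx) i.

Definition config_weights : 'I_n -> int := fun i => nth 0 wl i.

Definition config e kq kx : set (nat -> R) := fun v =>
  on_edges (config_edges e kq kx) (fun i => v i) /\
  principal (chip_div config_weights (config_edges e kq kx) (fun i => v i)).

Lemma config_points p (qs xs : seq Gamma) : size qs = k -> size xs = r ->
  \sum_(i < n) << nth 0 wl i *g nth p (ys ++ p :: qs ++ xs) i >> =
  D - << m%:Z *g p >> - \sum_(q <- qs) << q >> - \sum_(x <- xs) << x >>.
Proof.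
move=> sq sx; pose g (z : int * Gamma) : {freeg Gamma / int} := << z.1 *g z.2 >>.
have sumN (zs : seq Gamma) : \sum_(z <- zip (nseq (size zs) (-1)) zs) g z = - \sum_(x <- zs) << x >>.
  by elim: zs => [|z zs IH]; rewrite /= ?big_nil ?oppr0// !big_cons IH opprD /g /= freegUN.
transitivity (\sum_(z <- zip wl (ys ++ p :: qs ++ xs)) g z).
  rewrite (big_nth (0, p)) size_zip /wl !size_cat /= !size_cat !size_nseq size_map sq sx minnn.
  rewrite -/s big_mkord; apply: eq_bigr => i _; rewrite nth_zip//.
  by rewrite !size_cat /= !size_cat !size_nseq size_map sq sx.
rewrite /wl zip_cat ?size_map//= zip_cat ?size_nseq//.
rewrite big_cat big_cons big_cat /= -{1}sq -{1}sx !sumN.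
rewrite -[in RHS](freeg_sumE D) -/ys.
have -> : \sum_(z <- zip [seq coeff y D | y <- ys] ys) g z = \sum_(z <- ys) << coeff z D *g z >>.
  rewrite -[X in zip _ X]map_id -/ys; elim: (ys) => [|z zs IH]; rewrite /= ?big_nil// !big_cons.
  by rewrite IH.
by rewrite {1}/g /= -freegUN !addrA.
Qed.

Lemma chip_div_config p e kq kx v (qs xs : seq Gamma) :
  size kq = k -> size qs = k -> size xs = r ->
  (forall i, (i < s)%N -> v i = nth 0 [seq (chart y).2 | y <- ys] i) ->
  gam e (v s) = p ->
  (forall j, (j < k)%N -> gam (nth e kq j) (v (s.+1 + j)%N) = nth p qs j) ->
  (forall j, (j < r)%N -> gam (nth e kx j) (v (s.+1 + k + j)%N) = nth p xs j) ->
  chip_div config_weights (config_edges e kq kx) (fun i => v i) =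
  D - << m%:Z *g p >> - \sum_(q <- qs) << q >> - \sum_(x <- xs) << x >>.
Proof.
move=> skq sq sx vD vp vq vx; rewrite -config_points//; apply: eq_bigr => i _.
rewrite /config_weights /config_edges; congr << _ *g _ >>.
have sK : size [seq (chart y).1 | y <- ys] = s by rewrite size_map.
apply: (index_cases (P := fun i => gam (nth e ([seq (chart y).1 | y <- ys] ++ e :: kq ++ kx) i) (v i) =
  nth p (ys ++ p :: qs ++ xs) i)) => [{}i si||j jk|j jr|]; last exact: ltn_ord.
- by rewrite !(nth_D (s := s))// vD// !(nth_map p)// gam_chart.
- by rewrite !(nth_p (s := s)).
- by rewrite !(nth_q (s := s) (k := k))// vq.
- by rewrite !(nth_x (s := s) (k := k))// vx.
Qed.

Lemma on_edges_config e kq kx v : size kq = k ->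
  (forall i, (i < s)%N -> v i = nth 0 [seq (chart y).2 | y <- ys] i) ->
  0 <= v s <= len e ->
  (forall j, (j < k)%N -> 0 <= v (s.+1 + j)%N <= len (nth e kq j)) ->
  (forall j, (j < r)%N -> 0 <= v (s.+1 + k + j)%N <= len (nth e kx j)) ->
  on_edges (config_edges e kq kx) (fun i => v i).
Proof.
move=> skq vD vp vq vx i.
have sK : size [seq (chart y).1 | y <- ys] = s by rewrite size_map.
apply: (index_cases (P := fun i => 0 <= v i <=
    len (nth e ([seq (chart y).1 | y <- ys] ++ e :: kq ++ kx) i)))
  => [{}i si||j jk|j jr|]; last exact: ltn_ord.
- rewrite (nth_D (s := s))// vD//; have [y0 _] := @curve_nonempty _ Gamma.
  by rewrite !(nth_map y0)//; exact: chart_range.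
- by rewrite (nth_p (s := s)).
- by rewrite (nth_q (s := s) (k := k))// vq.
- by rewrite (nth_x (s := s) (k := k))// vx.
Qed.

(** Any coordinates of [p] and of the [qs] are allowed, since a point at a vertex has several. Only
    the coordinates of the effective divisor are quantified, over finitely many charts [kx]. *)
Lemma effective_config e u (kq : seq 'I_(edges M)) (tq : nat -> R) (qs : seq Gamma) :
  0 <= u <= len e -> size kq = k -> size qs = k ->
  (forall j, (j < k)%N -> 0 <= tq j <= len (nth e kq j)) ->
  (forall j, (j < k)%N -> gam (nth e kq j) (tq j) = nth (gam e u) qs j) ->
  (exists2 E, effective E &
     lin_equiv (D - << m%:Z *g gam e u >> - \sum_(q <- qs) << q >>) E) <->
  exists (kx : r.-tuple 'I_(edges M)) v,
    [/\ forall i, (i < s)%N -> v i = nth 0 [seq (chart y).2 | y <- ys] i,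
        v s = u, forall j, (j < k)%N -> v (s.+1 + j)%N = tq j & config e kq kx v].
Proof.
move=> ue skq sq tqE tqP; set p := gam e u; split=> [[E Eeff Elin]|].
  have [xs ExE] := effectiveP Eeff.
  (* Degree 0 of a principal divisor fixes the number of points of [E]. *)
  have sx : size xs = r.
    have := deg_principal Elin; rewrite !degB degU degD ExE !deg_sum_points sq.
    by rewrite !PoszD => h; apply/eqP; rewrite -eqz_nat; apply/eqP; lia.
  have skx : size [seq (chart x).1 | x <- xs] == r by rewrite size_map sx.
  pose v (i : nat) := nth 0 ([seq (chart y).2 | y <- ys] ++ u ::
    mkseq tq k ++ [seq (chart x).2 | x <- xs]) i.
  exists (Tuple skx), v.
  have sD : size [seq (chart y).2 | y <- ys] = s by rewrite size_map.
  have stq : size (mkseq tq k) = k by rewrite size_mkseq.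
  have vD i : (i < s)%N -> v i = nth 0 [seq (chart y).2 | y <- ys] i.
    by move=> si; rewrite /v (nth_D (s := s)).
  have vp : v s = u by rewrite /v (nth_p (s := s)).
  have vq j : (j < k)%N -> v (s.+1 + j)%N = tq j.
    by move=> jk; rewrite /v (nth_q (s := s) (k := k))// nth_mkseq.
  have vx j : (j < r)%N -> v (s.+1 + k + j)%N = (chart (nth p xs j)).2.
    by move=> jr; rewrite /v (nth_x (s := s) (k := k))// (nth_map p) ?sx.
  have kxj j : (j < r)%N -> nth e (Tuple skx) j = (chart (nth p xs j)).1.
    by move=> jr; rewrite /= (nth_map p) ?sx.
  split=> //; split.
    apply: on_edges_config => //; first by rewrite vp.
      by move=> j jk; rewrite vq//; exact: tqE.
    by move=> j jr; rewrite vx// kxj//; exact: chart_range.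
  rewrite (@chip_div_config p e kq (Tuple skx) v qs xs)//; last 3 first.
  - by rewrite vp.
  - by move=> j jk; rewrite vq//; exact: tqP.
  - by move=> j jr; rewrite vx// kxj// gam_chart.
  by rewrite -ExE.
move=> [kx [v [vD vp vq [vE vP]]]].
pose xs := mkseq (fun j => gam (nth e kx j) (v (s.+1 + k + j)%N)) r.
exists (\sum_(x <- xs) << x >>); first exact: effective_sum.
rewrite /lin_equiv -/(principal _).
rewrite -(@chip_div_config p e kq kx v qs xs) ?size_mkseq//.
- by rewrite vp.
- by move=> j jk; rewrite vq//; exact: tqP.
- by move=> j jr; rewrite /xs nth_mkseq.
Qed.

End EffectiveClasses.

(** * Rank loci are semilinear and closed *)

Section RankLoci.
Context {R : realType} {Gamma : tropical_curve R} (M : model Gamma).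
Implicit Types (D E : {freeg Gamma / int}) (p : Gamma) (A : set Gamma).

Definition edge_semilinear A : Prop := forall e : 'I_(edges M),
  exists L : seq (R * R), forall u u', 0 <= u <= len e -> 0 <= u' <= len e ->
    (forall l, l \in L -> Num.sg (l.1 * u + l.2) = Num.sg (l.1 * u' + l.2)) ->
    A (gam e u) -> A (gam e u').

Lemma edge_semilinear_bigcap (T : finType) (A : T -> set Gamma) :
  (forall i, edge_semilinear (A i)) -> edge_semilinear (\bigcap_(i in [set: T]) A i).
Proof.
move=> As e; exists (flatten [seq sval (cid (As i e)) | i <- enum T]) => u u' ue u'e uu' Au i _.
apply: (svalP (cid (As i e)) u u' ue u'e) (Au i I) => l lL; apply: uu'.
by apply/flatten_mapP; exists i; rewrite ?mem_enum.
Qed.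

Definition rank_locus D (m k : nat) : set Gamma :=
  [set p | rank_at_least (D - << m%:Z *g p >>) k].

(** Tested on [k] copies of [p]. This provides the number [r] as soon as the locus has a point. *)
Lemma rank_locus_deg D m k p : rank_locus D m k p -> exists r : nat, deg D = (m + k + r)%:Z.
Proof.
move=> /(_ (nseq_tuple k p))[E /effectiveP[xs ->] /(deg_principal M)].
rewrite !degB degU !deg_sum_points size_tuple => dE; exists (size xs).
by rewrite !PoszD; lia.
Qed.

Context (D : {freeg Gamma / int}) (m k r : nat).
Context (degD : deg D = (m + k + r)%:Z).
Let s := size (dom D).
Let n := (s + (1 + (k + r)))%N.
Let tD := [seq (chart M y).2 | y <- dom D].
Let sD : size tD = s. Proof. by rewrite size_map. Qed.

Lemma rank_locus_semilinear : edge_semilinear (rank_locus D m k).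
Proof.
move=> e.
(* Entries below [s] are the fixed positions of the support of [D], entry [s] is the position of
   [p]; later entries are rebound by the quantifiers in [S]. *)
pose v0 (u : R) (i : nat) := if (i < s)%N then nth 0 tD i else u.
pose S : set (nat -> R) := fun v => forall kq, kq \in enum {: k.-tuple 'I_(edges M)} ->
  all_from s.+1 (fun v => (forall j, j \in iota 0 k ->
      0 <= v (s.+1 + j)%N <= len (nth e kq j)) ->
    exists2 kx, kx \in enum {: r.-tuple 'I_(edges M)} &
      ex_from (s.+1 + k) (config D m k r e kq kx) v) v.
have nE : (s.+1 + k + r = n)%N by rewrite /n; lia.
have [L LS] : semilinear_set s.+1 S.
  apply: semilinear_bigcap => kq _; apply: (@semilinear_all_from _ s.+1 k).
  apply: semilinear_imply.
    apply: semilinear_bigcap => j; rewrite mem_iota => /andP[_ jk].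
    by apply: semilinear_itv; rewrite ltn_add2l.
  apply: semilinear_bigcup => kx _; apply: (@semilinear_ex_from _ (s.+1 + k) r).
  by rewrite nE; exact: semilinear_principal.
have SP u : 0 <= u <= len e -> rank_locus D m k (gam e u) <-> S (v0 u).
  move=> ue; split=> [Au kq _ v vv0 vq|Su qs].
    have vD i : (i < s)%N -> v i = nth 0 tD i.
      by move=> si; rewrite vv0 ?/v0 ?si// ltnW.
    have vp : v s = u by rewrite vv0 // /v0 ltnn.
    have sqs : size (mkseq (fun j => gam (nth e kq j) (v (s.+1 + j)%N)) k) == k.
      by rewrite size_mkseq.
    have [kx [v' [v'D v'p v'q cv']]] := (effective_config degD (kq := kq)
      (tq := fun j => v (s.+1 + j)%N) (qs := Tuple sqs) ue (size_tuple _) (size_tuple _)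
      (fun j jk => vq j ltac:(by rewrite mem_iota)) ltac:(by move=> j jk; rewrite nth_mkseq)).1
      (Au (Tuple sqs)).
    exists kx; first by rewrite mem_enum.
    exists v' => // i; rewrite -/s in v'D v'p v'q; have [si|] := ltnP i s.
      by move=> _; rewrite v'D// vD.
    rewrite leq_eqVlt => /predU1P[<-|si]; first by rewrite v'p vp.
    by move=> isk; rewrite -(subnKC si); apply: v'q; lia.
  pose p := gam e u.
  pose v i := if (i < s.+1)%N then v0 u i else (chart M (nth p qs (i - s.+1))).2.
  have skq : size [seq (chart M q).1 | q <- qs] == k by rewrite size_map size_tuple.
  have vqE j : (j < k)%N -> v (s.+1 + j)%N = (chart M (nth p qs j)).2.
    by move=> jk; rewrite /v ltnNge leq_addr /= addKn.
  have kqE j : (j < k)%N -> nth e (Tuple skq) j = (chart M (nth p qs j)).1.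
    by move=> jk; rewrite (nth_map p) ?size_tuple.
  have [|i is_|j|kx _ [v' v'v cv']] := Su (Tuple skq) _ v _ _.
  - by rewrite mem_enum.
  - by rewrite /v is_.
  - rewrite mem_iota => /andP[_ jk].
    by rewrite vqE// kqE//; exact: chart_range.
  apply: (effective_config degD (kq := Tuple skq)
    (tq := fun j => v (s.+1 + j)%N) (qs := qs) ue _ _ _ _).2; rewrite ?size_tuple//.
  - by move=> j jk; rewrite vqE// kqE//; exact: chart_range.
  - by move=> j jk; rewrite vqE// kqE// gam_chart.
  have v'E i : (i < s.+1)%N -> v' i = v0 u i.
    by move=> is_; rewrite v'v /v ?is_// (leq_trans is_)// leq_addr.
  exists kx, v'; split=> //.
  - by move=> i si; rewrite (v'E _ (ltnW si)) /v0 si.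
  - by rewrite (v'E _ (ltnSn s)) /v0 ltnn.
  - by move=> j jk; rewrite v'v// ltn_add2l.
(* Substituting the positions of the support of [D] leaves forms in [u] alone. *)
exists [seq (l.1 s, aeval s l (fun i => nth 0 tD i)) | l <- L] => u u' ue u'e uu'.
move=> /(SP _ ue) Su; apply/(SP _ u'e); apply: LS Su => l lL.
have aE x : aeval s.+1 l (v0 x) = l.1 s * x + aeval s l (fun i => nth 0 tD i).
  rewrite /aeval big_ord_recr /= /v0 ltnn addrA addrC; congr (_ + (_ + _)).
  by apply: eq_bigr => i _; rewrite ltn_ord.
by rewrite !aE; apply: (uu' (_, _)); apply/mapP; exists l.
Qed.

(** For frozen [qs], the admissible [p] form a finite union, over the charts of [p] and of the
    effective divisor, of images of compact sets. *)
Lemma rank_locus_closed : closed (rank_locus D m k).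
Proof.
have [x0 _] := @curve_nonempty _ Gamma.
have [e0 _] := chart M x0.
rewrite (_ : rank_locus D m k = \bigcap_(qs in [set: k.-tuple Gamma])
  [set p | exists2 E, effective E &
     lin_equiv (D - << m%:Z *g p >> - \sum_(q <- qs) << q >>) E]); last first.
  by apply/seteqP; split=> p h qs => [_|]; [exact: h|exact: (h qs I)].
apply: closed_bigI => qs _.
have ordS : (s < n)%N by rewrite /n; lia.
pose is_ := Ordinal ordS.
have skq : size [seq (chart M q).1 | q <- qs] = k by rewrite size_map size_tuple.
have stq : size [seq (chart M q).2 | q <- qs] = k by rewrite size_map size_tuple.
pose kq := [seq (chart M q).1 | q <- qs].
pose tq := [seq (chart M q).2 | q <- qs].
(* The bounds coincide on the support of [D] and on the [qs], pinning these chips; the other chips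
   range over their whole edges. *)
pose lo (i : nat) : R := nth 0 (tD ++ 0 :: tq ++ nseq r 0) i.
pose hi (e : 'I_(edges M)) (kx : seq 'I_(edges M)) (i : nat) : R :=
  nth 0 (tD ++ len e :: tq ++ [seq len e' | e' <- kx]) i.
pose K (c : 'I_(edges M) * r.-tuple 'I_(edges M)) := [set v : 'rV[R]_n |
  (forall i : 'I_n, lo i <= v 0 i <= hi c.1 c.2 i) /\
  principal (chip_div (config_weights (D := D) m (k := k) (r := r))
    (config_edges (D := D) (k := k) (r := r) c.1 kq c.2) (fun i => v 0 i))].
have lohi e (kx : r.-tuple 'I_(edges M)) (i : 'I_n) :
    0 <= lo i /\ hi e kx i <= len (config_edges (D := D) (k := k) (r := r) e kq kx i).
  rewrite /config_edges /lo /hi.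
  have sK : size [seq (chart M y).1 | y <- dom D] = s by rewrite size_map.
  apply: (index_cases (P := fun i =>
    0 <= nth 0 (tD ++ 0 :: tq ++ nseq r 0) i /\
    nth 0 (tD ++ len e :: tq ++ [seq len e' | e' <- kx]) i <=
      len (nth e ([seq (chart M y).1 | y <- dom D] ++ e :: kq ++ kx) i)))
    => [{}i si||j jk|j jr|]; last exact: ltn_ord.
  - rewrite !(nth_D (s := s))// /tD !(nth_map x0)//.
    by have := chart_range M (nth x0 (dom D) i); lra.
  - by rewrite !(nth_p (s := s)).
  - rewrite !(nth_q (s := s) (k := k))// /tq /kq !(nth_map x0) ?size_tuple//.
    by have := chart_range M (nth x0 qs j); lra.
  - rewrite !(nth_x (s := s) (k := k))// nth_nseq if_same (nth_map e) ?size_tuple//.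
have Kis c v : K c v -> 0 <= v 0 is_ <= len c.1.
  move=> [vb _]; have := vb is_; rewrite /lo /hi.
  by rewrite !(nth_p (s := s)).
have isE c : config_edges (D := D) (k := k) (r := r) c.1 kq (c.2 : r.-tuple _) is_ = c.1.
  by rewrite /config_edges /= (nth_p (s := s))// size_map.
rewrite (_ : mkset _ = \bigcup_(c in [set: 'I_(edges M) * r.-tuple 'I_(edges M)])
    [set gam c.1 (v 0 is_) | v in K c]).
  apply: closed_bigcup => [|c _]; first exact: finite_finset.
  apply: compact_closed; first exact: metric_hausdorff.
  rewrite -[X in gam X](isE c).
  apply: gam_image_compact; first by move=> v /Kis; rewrite isE.
  by apply: principal_box_compact => i; exact: lohi.
have sk : size [seq (chart M y).1 | y <- dom D] = s by rewrite size_map.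
have kqE e j : (j < k)%N -> nth e kq j = (chart M (nth x0 qs j)).1.
  by move=> jk; rewrite (nth_map x0) ?size_tuple.
have tqE j : (j < k)%N -> nth 0 tq j = (chart M (nth x0 qs j)).2.
  by move=> jk; rewrite (nth_map x0) ?size_tuple.
have tq_range e j : (j < k)%N -> 0 <= nth 0 tq j <= len (nth e kq j).
  by move=> jk; rewrite kqE// tqE//; exact: chart_range.
have tq_gam e p j : (j < k)%N -> gam (nth e kq j) (nth 0 tq j) = nth p qs j.
  move=> jk; rewrite kqE// tqE// gam_chart; apply: set_nth_default.
  by rewrite size_tuple.
have classP e u : 0 <= u <= len e -> _ := fun ue => effective_config degD (qs := qs) ue skq
  (size_tuple qs) (tq_range e) (tq_gam e (gam e u)).
apply/seteqP; split=> [p /= h|p [[e kx] _ [v vK <-]] /=].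
  have pr := chart_range M p; rewrite -(gam_chart M p) in h.
  have [kx [v [vD vp vq [vE vP]]]] := (classP _ _ pr).1 h.
  exists ((chart M p).1, kx) => //; exists (\row_(i < n) v i); last first.
    by rewrite mxE /= vp gam_chart.
  have rowE : (fun i : 'I_n => (\row_(i < n) v i) 0 i) = (fun i : 'I_n => v i).
    by apply/funext => i; rewrite mxE.
  split=> [i|]; last by rewrite rowE.
  rewrite mxE; apply: (@index_cases s k r (fun i => lo i <= v i <= hi (chart M p).1 kx i))
    => [{}i si||j jk|j jr|]; last exact: ltn_ord; rewrite /lo /hi.
  - by rewrite !(nth_D (s := s))// vD// lexx.
  - by rewrite !(nth_p (s := s))// vp.
  - by rewrite !(nth_q (s := s) (k := k))// vq// lexx.
  - rewrite !(nth_x (s := s) (k := k))// nth_nseq if_same (nth_map (chart M p).1) ?size_tuple//.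
    have jn : (s.+1 + k + j < n)%N by rewrite /n; lia.
    have := vE (Ordinal jn); rewrite /config_edges /=.
    by rewrite (nth_x (s := s) (k := k)).
have ue := Kis _ _ vK; have [vb vP] := vK.
pose v' (i : nat) := if insub i is Some o then v 0 o else 0.
have v'E (i : 'I_n) : v' i = v 0 i by rewrite /v' valK.
have vbn i : (i < n)%N -> lo i <= v' i <= hi e kx i.
  by move=> iN; have := vb (Ordinal iN); rewrite -v'E.
apply: (classP e (v 0 is_) ue).2; exists kx, v'; split.
- move=> i si; have := vbn i (ltn_trans si ordS).
  by rewrite /lo /hi !(nth_D (s := s))// -eq_le => /eqP.
- exact: (v'E is_).
- move=> j jk; have := vbn (s.+1 + j)%N ltac:(rewrite /n; lia).
  by rewrite /lo /hi !(nth_q (s := s) (k := k))// -eq_le => /eqP.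
- have v'row : (fun i : 'I_n => v' i) = (fun i => v 0 i) by apply/funext.
  rewrite /config v'row; split=> // i.
  by have := vb i; have := lohi e kx i; rewrite /=; lra.
Qed.

End RankLoci.

(** * Connected components and gaps *)

Section Components.
Context {R : realType} {Gamma : tropical_curve R} (M : model Gamma).

Lemma affine_sign_convex (a b x y z : R) : x <= z <= y ->
  (0 < a * x + b) = (0 < a * y + b) -> (a * x + b < 0) = (a * y + b < 0) ->
  (0 < a * z + b) = (0 < a * x + b) /\ (a * z + b < 0) = (a * x + b < 0).
Proof.
move=> /andP[xz zy].
have key (X Y Z : R) : X <= Z <= Y -> (0 < X) = (0 < Y) -> (X < 0) = (Y < 0) ->
    (0 < Z) = (0 < X) /\ (Z < 0) = (X < 0) :> bool.
  move=> /andP[XZ ZY] XY YX; split; apply/idP/idP; rewrite ?XY ?YX => h.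
  - lra.
  - by move: h; rewrite -XY; lra.
  - by rewrite -YX; lra.
  - lra.
have [a0|/ltW a0] := leP 0 a.
  by apply: key; rewrite !lerD2r !ler_wpM2l.
move=> p q; rewrite p q; apply: key (esym p) (esym q).
by rewrite !lerD2r !ler_wnM2l.
Qed.

Lemma sgr_eq (x y : R) : (0 < x) = (0 < y) -> (x < 0) = (y < 0) -> Num.sg x = Num.sg y.
Proof.
have [x0|x0|->] := ltgtP x 0; have [y0|y0|->] := ltgtP y 0 => //.
  by rewrite !ltr0_sg.
by rewrite !gtr0_sg.
Qed.

(** On an edge, the points with a given vector of signs form an interval, lying entirely in [A] or
    entirely outside. Every component of [A] contains such a piece, and there are finitely many
    pairs of an edge and a sign vector. *)
Lemma edge_semilinear_components (A : set Gamma) : edge_semilinear M A ->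
  finite_set (connected_components A).
Proof.
move=> sA; pose L := flatten [seq sval (cid (sA e)) | e <- enum 'I_(edges M)].
pose N := size L; pose form (i : 'I_N) u : R := (nth 0 L i).1 * u + (nth 0 L i).2.
pose sig u : {ffun 'I_N -> bool * bool} := [ffun i => (0 < form i u, form i u < 0)].
have sigA (e : 'I_(edges M)) u u' : 0 <= u <= len e -> 0 <= u' <= len e ->
    sig u = sig u' -> A (gam e u) -> A (gam e u').
  move=> ue u'e uu'; apply: (svalP (cid (sA e)) u u' ue u'e) => l lL.
  have lL' : l \in L by apply/flatten_mapP; exists e; rewrite ?mem_enum.
  have iN : (index l L < N)%N by rewrite index_mem.
  move/ffunP: uu' => /(_ (Ordinal iN)); rewrite !ffunE /form /= nth_index// => -[h1 h2].
  exact: sgr_eq.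
pose piece (c : 'I_(edges M) * {ffun 'I_N -> bool * bool}) : set R :=
  [set u | 0 <= u <= len c.1 /\ sig u = c.2].
have piece_itv c : is_interval (piece c).
  move=> x y [xe xs] [ye ys] z xzy; split; first lra.
  apply/ffunP => i; rewrite -xs !ffunE.
  have := ys; rewrite -xs => /ffunP/(_ i); rewrite !ffunE => -[h1 h2].
  by have [-> ->] := affine_sign_convex xzy (esym h1) (esym h2).
have [x0 _] := @curve_nonempty _ Gamma.
(* For an empty piece the value is junk, which is harmless as only the finiteness of the range
   matters. *)
pose comp c := connected_component A (gam c.1 (xget 0 (piece c))).
apply: (@sub_finite_set _ _ (range comp)); last exact/finite_image/finite_finset.
move=> _ [x Ax <-]; have [e [u [ue uE]]] := gam_cover M x.
exists (e, sig u) => //=; rewrite /comp /=.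
have [u'e su'] : piece (e, sig u) (xget 0 (piece (e, sig u))) by apply: xgetPex; exists u.
set u' := xget _ _ in u'e su' *.
apply/esym/same_connected_component.
apply: (@connected_component_max _ A [set gam e v | v in piece (e, sig u)]).
- by exists u.
- move=> _ [v [ve vs] <-]; apply: (sigA e u v ue ve); first by rewrite vs.
  by rewrite uE.
- apply: connected_continuous_connected; first exact/connected_intervalP/piece_itv.
  apply: continuous_subspaceW (isometric_within_continuous (@gam_isometry _ _ M e)).
  by move=> v [ve _] /=; rewrite in_itv.
- by exists u'.
Qed.

End Components.

(** * Rank and the counting of gaps *)

Section Gaps.
Context {R : realType} {Gamma : tropical_curve R}.
Implicit Types (D E : {freeg Gamma / int}) (p : Gamma).

Lemma effectiveD E E' : effective E -> effective E' -> effective (E + E').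
Proof. by move=> e e' p; rewrite coeffD addr_ge0. Qed.

Lemma effective_point p : effective << p >>.
Proof. by move=> q; rewrite coeffU mul1r; case: (p == q). Qed.

Lemma rank_at_least_add D p k : rank_at_least (D - << p >>) k -> rank_at_least D k.
Proof.
move=> h t; have [E Eeff Elin] := h t; exists (E + << p >>).
  exact: effectiveD Eeff (effective_point p).
move: Elin; rewrite /lin_equiv.
by rewrite opprD addrA [D - << p >> - _]addrAC [_ - << p >> - E]addrAC.
Qed.

Lemma rank_at_least_sub D p k : rank_at_least D k.+1 -> rank_at_least (D - << p >>) k.
Proof.
move=> h t; have [E Eeff Elin] := h [tuple of p :: t]; exists E => //.
by move: Elin; rewrite /lin_equiv big_cons opprD addrA.
Qed.

Lemma rank_at_leastW D j k : (j <= k)%N -> rank_at_least D k -> rank_at_least D j.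
Proof.
have [p _] := @curve_nonempty _ Gamma.
move=> /subnK <-; elim: (k - j)%N => // i IH /rank_at_least_sub h.
by apply: IH; apply: (@rank_at_least_add _ p); exact: h.
Qed.

Lemma rank_at_least_deg D k : rank_at_least D k -> k%:Z <= deg D.
Proof.
have [M _] := model_of_curve Gamma; have [p _] := @curve_nonempty _ Gamma.
move=> /(_ (nseq_tuple k p))[E /effectiveP[xs ->] /(deg_principal M)].
by rewrite !degB !deg_sum_points size_tuple => dE; lia.
Qed.

(** The degree bounds the candidates, so a maximum exists and [xget] returns it. *)
Lemma rankE D : rank_candidates D (rank D) /\ ubound (rank_candidates D) (rank D).
Proof.
apply: (@xgetPex _ (-1) [set k | rank_candidates D k /\ ubound (rank_candidates D) k]).
have [[k Dk]|none] := pselect (exists k, rank_at_least D k); last first.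
  exists (-1); split; first by left.
  by move=> x [->//|[k _ Dk]]; case: none; exists k.
have ex : exists k, `[< rank_at_least D k >] by exists k; apply/asboolP.
have ub i : `[< rank_at_least D i >] -> (i <= absz (deg D))%N.
  by move=> /asboolP/rank_at_least_deg; lia.
case: (ex_maxnP ex ub) => m /asboolP Dm mmax; exists m%:Z.
split; first by right; exists m.
move=> x [->//|[i -> Di]]; rewrite lez_nat.
by apply: mmax; apply/asboolP.
Qed.

Lemma rank_ge D : -1 <= rank D.
Proof. by have [_ ub] := rankE D; apply: ub; left. Qed.

Lemma rank_geP D k : k%:Z <= rank D <-> rank_at_least D k.
Proof.
have [cand ub] := rankE D; split=> [kD|Dk]; last by apply: ub; right; exists k.
case: cand => [rD|[m mE Dm]]; first by move: kD; rewrite rD.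
by apply: rank_at_leastW Dm; move: kD; rewrite mE.
Qed.

Lemma rank_le D D' : (forall k, rank_at_least D k -> rank_at_least D' k) -> rank D <= rank D'.
Proof.
move=> h; have [[->|[m mE Dm]] _] := rankE D; first exact: rank_ge.
by rewrite mE; apply/rank_geP/h.
Qed.

Lemma rank_subpoint D p : rank (D - << p >>) <= rank D <= rank (D - << p >>) + 1.
Proof.
apply/andP; split; first by apply: rank_le => k; exact: rank_at_least_add.
have [[->|[[|m] mE Dm]] _] := rankE D; first by have := rank_ge (D - << p >>); lia.
  by have := rank_ge (D - << p >>); lia.
have /rank_geP : rank_at_least (D - << p >>) m by exact: rank_at_least_sub.
by rewrite mE; lia.
Qed.

Lemma rank_neg_deg D : deg D < 0 -> rank D = -1.
Proof.
move=> dD; have [[//|[m mE Dm]] _] := rankE D.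
by have := rank_at_least_deg Dm; lia.
Qed.

Context (D : {freeg Gamma / int}) (p : Gamma).
Let rho (j : nat) : int := rank (D - << j%:Z *g p >>).

Let rhoS j : rho j.+1 <= rho j <= rho j.+1 + 1.
Proof.
have -> : rho j.+1 = rank (D - << j%:Z *g p >> - << p >>).
  by rewrite /rho -addrA -opprD freegUD; congr (rank (D - << _ *g p >>)); lia.
exact: rank_subpoint.
Qed.

Let gap_list (i N : nat) : seq int := [seq j.+1%:Z | j <- iota i N & rho j.+1 < rho j].

(** Telescoping: [rho] drops by exactly 1 at each gap and is constant elsewhere. *)
Let size_gap_list N : (size (gap_list 0 N))%:Z = rho 0 - rho N.
Proof.
elim: N => [|N IH]; first by rewrite subrr.
rewrite /gap_list -addn1 iotaD filter_cat map_cat size_cat PoszD IH add0n /=.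
by have := rhoS N; rewrite addn1; case: ltP => /= ? ?; lia.
Qed.

Let gap_seqE N : deg D < N%:Z -> gap_seq D p = gap_list 0 N.
Proof.
move=> dN.
have rhoN j : (N <= j)%N -> rho j = -1.
  by move=> Nj; apply: rank_neg_deg; rewrite degB degU; lia.
have gapE : gaps D p = [set` gap_list 0 N].
  apply/seteqP; split=> [z [z0 zgap]|z /= /mapP[j]]; last first.
    rewrite mem_filter => /andP[jgap _] ->; split=> //.
    by rewrite (_ : j.+1%:Z - 1 = j%:Z); [exact: jgap|lia].
  case: z z0 zgap => // -[//|j] _; rewrite (_ : j.+1%:Z - 1 = j%:Z); last lia.
  move=> zgap; apply/mapP; exists j => //; rewrite mem_filter zgap mem_iota /= add0n.
  by rewrite ltnNge; apply/negP => Nj; move: zgap; rewrite -/(rho _) -/(rho j) !rhoN// ltnW.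
apply: (sorted_eq le_trans le_anti).
- exact: (sort_sorted le_total).
- apply: (sub_sorted ltW); rewrite /gap_list sorted_map.
  apply: (sub_sorted (e := ltn)) => [i j ij|]; first by rewrite /= ltz_nat ltnS.
  by apply: sorted_filter (iota_ltn_sorted _ _); exact: ltn_trans.
- rewrite /gap_seq perm_sort; apply: uniq_perm => [|| z].
  + exact: fset_uniq.
  + rewrite map_inj_uniq; first exact/filter_uniq/iota_uniq.
    by move=> i j [].
  + rewrite (_ : (z \in enum_fset _) = (z \in fset_set (gaps D p)))//.
    rewrite gapE in_fset_set; last exact: finite_seq.
    by apply/idP/idP => [/set_mem//|zg]; exact: mem_set.
Qed.

(** The entry of index [i], counted from 0, exceeds [a] iff at most [i] gaps are at most [a]. Their
    number is [rho 0 - rho a = r - rho a], so this says [rho a >= r - i]. *)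
Lemma gap_geP (r i a : nat) : rank D = r%:Z -> (i <= r)%N ->
  a.+1%:Z <= (gap_seq D p)`_i <-> rank_at_least (D - << a%:Z *g p >>) (r - i).
Proof.
move=> rD ir; pose b := (absz (deg D)).+1.
rewrite (@gap_seqE (a + b)%N); last by rewrite /b; lia.
have rho0 : rho 0 = r%:Z by rewrite /rho freegU0 subr0.
have rhoN : rho (a + b) = -1.
  by apply: rank_neg_deg; rewrite degB degU /b; lia.
have sN := size_gap_list (a + b); have sa := size_gap_list a.
(* The list is split into the gaps at most [a] and those beyond [a]. *)
have cat : gap_list 0 (a + b) = gap_list 0 a ++ gap_list a b.
  by rewrite /gap_list iotaD filter_cat map_cat add0n.
rewrite -rank_geP -/(rho a) cat nth_cat.
have si : (i < size (gap_list 0 (a + b)))%N by lia.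
case: ltnP => ia; split.
- have /mapP[j] : (gap_list 0 a)`_i \in gap_list 0 a by exact: mem_nth.
  by rewrite mem_filter mem_iota => /andP[_ ja] ->; lia.
- move=> h; exfalso; move: h sa ia rho0; rewrite -subzn//.
  by move: (rho a) (rho 0) (size _) => x y z; lia.
- move=> _; move: sa ia rho0; rewrite -subzn//.
  by move: (rho a) (rho 0) (size _) => x y z; lia.
- have /mapP[j] : (gap_list a b)`_(i - size (gap_list 0 a)) \in gap_list a b.
    by apply: mem_nth; rewrite ltn_subLR// -size_cat -cat.
  by rewrite mem_filter mem_iota => /andP[_ ja] -> _; lia.
Qed.

End Gaps.

Theorem theorem1p6 (R : realType) (Gamma : tropical_curve R) (g : nat)
    (hg : has_genus Gamma g) (g_ge2 : (2 <= g)%N)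
    (D : {freeg Gamma / int}) (d : int) (hd : deg D = d)
    (r : nat) (hr : rank D = r%:Z)
    (n : 'I_r.+1 -> int) (hn : gap_poset d n) :
  closed (WL_ge D n) /\ finite_set (connected_components (WL_ge D n)).
Proof.
have [n0 nmono _] := hn.
have n1 i : 1 <= n i.
  have [->//|i0] := eqVneq i ord0.
  apply: (le_trans n0); apply/ltW/nmono.
  by rewrite lt0n; apply: contra_neq i0 => i0; exact: val_inj.
pose m i := absz (n i - 1).
have nE i : n i = (m i).+1%:Z by have := n1 i; rewrite /m; lia.
have WLE : WL_ge D n = \bigcap_(i in [set: 'I_r.+1]) rank_locus D (m i) (r - i).
  apply/seteqP; split=> p h i.
    by move=> _; apply/(gap_geP _ _ hr); [rewrite -ltnS|rewrite -nE].
  by rewrite nE; apply/(gap_geP _ _ hr); [rewrite -ltnS|exact: (h i I)].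
have [M _] := model_of_curve Gamma.
(* A point of the locus shows that [deg D] is at least [m i + (r - i)] for every [i]; the excess is
   the degree of the effective divisors that the rank loci involve. *)
have [[p Wp]|W0] := pselect (WL_ge D n !=set0); last first.
  have -> : WL_ge D n = set0 by apply/seteqP; split=> // p Wp; case: W0; exists p.
  split; first exact: closed0.
  by rewrite /connected_components image_set0.
have degW i : exists k, deg D = (m i + (r - i) + k)%:Z.
  by move: Wp; rewrite WLE => /(_ i I)/(rank_locus_deg M).
split.
  rewrite WLE; apply: closed_bigI => i _; have [k dk] := degW i.
  exact: (rank_locus_closed M dk).
apply: (@edge_semilinear_components _ _ M); rewrite WLE.
apply: edge_semilinear_bigcap => i; have [k dk] := degW i.
exact: rank_locus_semilinear dk.
Qed.
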